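(* Let $(\mathcal R,\Lambda,S)$ be a generalized Renner-Coxeter system with $\mathcal R$ finite, let $\varepsilon\in\{+,-\}$, let $r,s\in\mathcal R$ be arbitrary, and let $\mathscr T$ be one of Green's relations $\mathscr J,\mathscr L,\mathscr R,\mathscr H$, with $T_r$ denoting the $\mathscr T$-class of $r$. Consider the statements: (1) $\min^{\varepsilon}T_r\leq^{\varepsilon}\min^{\varepsilon}T_s$; (2) $\max^{\varepsilon}T_r\leq^{\varepsilon}\max^{\varepsilon}T_s$; (3) there exist $a\in T_r$ and $b\in T_s$ with $a\leq^{\varepsilon}b$. If $\mathscr T=\mathscr J$, $\mathscr L$ or $\mathscr R$, then (1), (2) and (3) are equivalent. If $\mathscr T=\mathscr H$, then (2) and (3) are equivalent, whereas (1) is in general not equivalent to them (there exist a finite generalized Renner-Coxeter system, a sign $\varepsilon$, and elements $r,s$ for which the equivalence with (1) fails).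
   Context: For a Coxeter system $(W,S)$, $\leq$ is the Bruhat order. For $I\subseteq S$, $W_I$ is the subgroup generated by $I$; $W^I$ (resp. ${}^IW$) is the set of $w\in W$ that are the Bruhat-minimum of $wW_I$ (resp. $W_Iw$). A generalized Renner-Coxeter system is a triple $(\mathcal R,\Lambda,S)$ such that: (i) $\mathcal R$ is a factorizable monoid with group of units $W$, i.e. $\mathcal R=E(\mathcal R)W=WE(\mathcal R)$, where the set $E(\mathcal R)$ of idempotents is a meet semilattice under $e\leq f\Leftrightarrow ef=fe=e$ (meet = product; thus $\mathcal R$ is an inverse monoid); (ii) $\Lambda$ is a transversal of $E(\mathcal R)$ for the conjugation action of $W$ and a sub-meet semilattice; (iii) $(W,S)$ is a Coxeter system; (iv) for every $e\leq e'$ in $E(\mathcal R)$ there are $w\in W$ and $f\leq f'$ in $\Lambda$ with $wew^{-1}=f$, $we'w^{-1}=f'$; (v) the map $\lambda^*(e)=\{s\in S\mid se=es\neq e\}$ on $\Lambda$ satisfies $e\leq f\Rightarrow\lambda^*(e)\subseteq\lambda^*(f)$; (vi) for every $e\in\Lambda$, $\{w\in W\mid we=ew\}$ and $\{w\in W\mid we=ew=e\}$ are standard parabolic subgroups of $W$. The subsets $\lambda(e),\lambda_*(e)\subseteq S$ are defined by $W_{\lambda(e)}=\{w\in W\mid we=ew\}$ and $W_{\lambda_*(e)}=\{w\in W\mid we=ew=e\}$. Each $r\in\mathcal R$ has a unique left standard form $r=xey$ ($e\in\Lambda$, $x\in W^{\lambda_*(e)}$, $y\in{}^{\lambda(e)}W$)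 and a unique right standard form $r=yex$ ($e\in\Lambda$, $y\in W^{\lambda(e)}$, $x\in{}^{\lambda_*(e)}W$). Adherence orders: if $r=xey$, $s=afb$ are in left standard form, $r\leq^{+}s$ iff $e\leq f$ and there is $w\in W_{\lambda^*(f)}W_{\lambda_*(e)}$ with $x\leq aw$ and $w^{-1}b\leq y$. If $r=yex$, $s=bfa$ are in right standard form, $r\leq^{-}s$ iff $e\leq f$ and there is $w\in W_{\lambda_*(e)}W_{\lambda^*(f)}$ with $x\leq wa$ and $bw^{-1}\leq y$. Green's relations: $r\mathscr Js$ iff $\mathcal Rr\mathcal R=\mathcal Rs\mathcal R$ (iff $WrW=WsW$); $r\mathscr Ls$ iff $\mathcal Rr=\mathcal Rs$ (iff $Wr=Ws$); $r\mathscr Rs$ iff $r\mathcal R=s\mathcal R$ (iff $rW=sW$); $\mathscr H=\mathscr L\cap\mathscr R$. $\max^{\varepsilon}T_r$ (resp. $\min^{\varepsilon}T_r$) is the element $s\in T_r$ with $t\leq^{\varepsilon}s$ (resp. $s\leq^{\varepsilon}t$) for all $t\in T_r$; for finite $\mathcal R$ and $\mathscr T\in\{\mathscr J,\mathscr L,\mathscr R,\mathscr H\}$ these always exist. *)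

(* Defs.v *)
From HB Require Import structures.
From mathcomp Require Import all_boot.

Set Implicit Arguments.
Unset Strict Implicit.
Unset Printing Implicit Defensive.

Local Open Scope group_scope.

#[short(type="finMonoidType")]
HB.structure Definition FinMonoid := {R of Monoid R & Finite R}.

Section FiniteMonoid.

Variable R : finMonoidType.
Implicit Types (A B I S L : {set R}) (e f g r s t u v w x y : R).

Definition mulset A B : {set R} := [set a * b | a in A, b in B].

Definition unit_group : {set R} := [set w | [exists v, (w * v == 1) && (v * w == 1)]].

(* As for ring inverses, non-units are mapped to themselves. *)
Definition uinv w : R := odflt w [pick v | (w * v == 1) && (v * w == 1)].

Definition is_subgroup A : bool :=
  [&& A \subset unit_group, 1 \in A,
      [forall x in A, forall y in A, x * y \in A] & [forall x in A, uinv x \in A]].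

(* The subgroup of the group of units generated by I (meaningful only when
   I \subset unit_group); for I \subset S this is the standard parabolic W_I. *)
Definition gen I : {set R} :=
  \bigcap_(A : {set R} | is_subgroup A && (I \subset A)) A.

(* The value 0 encodes m(s, t) = oo: the relation (s t) ^ 0 = 1 is void. *)
Definition coxeter_matrix S (m : R -> R -> nat) : Prop :=
  [/\ {in S, forall s, m s s = 1%N},
      {in S &, forall s t, m s t = m t s}
    & {in S &, forall s t, s != t -> m s t != 1%N}].

(* The group of units is presented by the generators S and the relations
   (s t) ^ m(s, t) = 1, i.e. it has the universal property of that presentation. *)
Definition coxeter_system S : Prop :=
  [/\ S \subset unit_group, gen S = unit_group
    & exists m : R -> R -> nat,
      [/\ coxeter_matrix S m,
          {in S &, forall s t, (s * t) ^+ m s t = 1}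
        & forall (G : groupType) (h : R -> G),
            {in S &, forall s t, (h s * h t) ^+ m s t = 1} ->
            exists2 phi : R -> G,
              {in unit_group &, forall x y, phi (x * y) = phi x * phi y}
            & {in S, phi =1 h}]].

Definition words S (n : nat) : {set R} := iter n (fun A => mulset A S) [set 1].

(* Coxeter length: the least n such that w is a product of n elements of S.
   If S generates the group of units, every unit has length less than #|R|. *)
Definition clength S w : nat := find (fun n => w \in words S n) (iota 0 #|R|).

Definition reflections S : {set R} :=
  [set w * s * uinv w | w in unit_group, s in S].

Definition bruhat S : rel R :=
  connect [rel u v | [exists t in reflections S, v == u * t] &&
                     (clength S u < clength S v)%N].

(* W^I and ^I W *)
Definition lmin_reps S I : {set R} :=
  [set w in unit_group | [forall v in gen I, bruhat S w (w * v)]].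
Definition rmin_reps S I : {set R} :=
  [set w in unit_group | [forall v in gen I, bruhat S w (v * w)]].

Definition idems : {set R} := [set e | e * e == e].

Definition idem_le : rel R := [rel e f | (e * f == e) && (f * e == e)].

Definition is_meet e f g : Prop :=
  [/\ g \in idems, idem_le g e, idem_le g f
    & forall h, h \in idems -> idem_le h e -> idem_le h f -> idem_le h g].

Definition ucent e : {set R} := [set w in unit_group | w * e == e * w].
Definition ustab e : {set R} := [set w in unit_group | (w * e == e) && (e * w == e)].

Definition lambda_up S e : {set R} := [set s in S | (s * e == e * s) && (s * e != e)].

Definition is_std_parabolic S A : Prop := exists2 I : {set R}, I \subset S & gen I = A.

(* The subset I of S such that gen I = A (junk set0 if there is none). *)
Definition parabolic_type S A : {set R} :=
  odflt set0 [pick I : {set R} | (I \subset S) && (gen I == A)].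

Definition lambda S e : {set R} := parabolic_type S (ucent e).
Definition lambda_down S e : {set R} := parabolic_type S (ustab e).

Record renner_coxeter L S : Prop := RennerCoxeter {
  rc_factorizable : mulset idems unit_group = setT /\ mulset unit_group idems = setT;
  rc_meet : {in idems &, forall e f, is_meet e f (e * f)};
  rc_lattice_sub : L \subset idems;
  rc_transversal : forall e, e \in idems ->
    exists! f, f \in L /\ exists2 w, w \in unit_group & w * e * uinv w = f;
  rc_lattice_meet : {in L &, forall e f, e * f \in L};
  rc_coxeter : coxeter_system S;
  rc_chain : forall e e', e \in idems -> e' \in idems -> idem_le e e' ->
    exists w f f', [/\ w \in unit_group, f \in L /\ f' \in L, idem_le f f',
                       w * e * uinv w = f & w * e' * uinv w = f'];
  rc_lambda_up : {in L &, forall e f, idem_le e f -> lambda_up S e \subset lambda_up S f};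
  rc_ucent : {in L, forall e, is_std_parabolic S (ucent e)};
  rc_ustab : {in L, forall e, is_std_parabolic S (ustab e)}
}.

Definition left_standard L S r x e y : Prop :=
  [/\ r = x * e * y, e \in L, x \in lmin_reps S (lambda_down S e)
    & y \in rmin_reps S (lambda S e)].

Definition right_standard L S r y e x : Prop :=
  [/\ r = y * e * x, e \in L, y \in lmin_reps S (lambda S e)
    & x \in rmin_reps S (lambda_down S e)].

Definition adh_plus L S r s : Prop :=
  exists x e y a f b,
    [/\ left_standard L S r x e y, left_standard L S s a f b, idem_le e f
      & exists w, [/\ w \in mulset (gen (lambda_up S f)) (gen (lambda_down S e)),
                      bruhat S x (a * w) & bruhat S (uinv w * b) y]].

Definition adh_minus L S r s : Prop :=
  exists y e x b f a,
    [/\ right_standard L S r y e x, right_standard L S s b f a, idem_le e f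
      & exists w, [/\ w \in mulset (gen (lambda_down S e)) (gen (lambda_up S f)),
                      bruhat S x (w * a) & bruhat S (b * uinv w) y]].

Definition greenL r s : Prop := [set x * r | x : R] = [set x * s | x : R].
Definition greenR r s : Prop := [set r * x | x : R] = [set s * x | x : R].
Definition greenJ r s : Prop :=
  [set x * r * y | x : R, y : R] = [set x * s * y | x : R, y : R].
Definition greenH r s : Prop := greenL r s /\ greenR r s.

End FiniteMonoid.

Variant adh_sign := AdhPlus | AdhMinus.

Variant green := GreenJ | GreenL | GreenR | GreenH.

Section MinMax.

Variables (R : finMonoidType) (L S : {set R}) (eps : adh_sign) (T : green).

Definition adh (r s : R) : Prop :=
  match eps with AdhPlus => adh_plus L S r s | AdhMinus => adh_minus L S r s end.

(* in_class r t means that t lies in the class T_r. *)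
Definition in_class (r t : R) : Prop :=
  match T with
  | GreenJ => greenJ r t
  | GreenL => greenL r t
  | GreenR => greenR r t
  | GreenH => greenH r t
  end.

Definition is_min_class (r m : R) : Prop :=
  in_class r m /\ forall t, in_class r t -> adh m t.

Definition is_max_class (r m : R) : Prop :=
  in_class r m /\ forall t, in_class r t -> adh t m.

Definition min_class_le (r s : R) : Prop :=
  exists m n, [/\ is_min_class r m, is_min_class s n & adh m n].

Definition max_class_le (r s : R) : Prop :=
  exists m n, [/\ is_max_class r m, is_max_class s n & adh m n].

Definition some_class_le (r s : R) : Prop :=
  exists a b, [/\ in_class r a, in_class s b & adh a b].

End MinMax.

(* Main.v *)
Require Import Defs.
From HB Require Import structures.
From mathcomp Require Import all_boot all_fingroup.

(* Write r = xey in left standard form. The J-, L-, R- and H-class of r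
   consist of the x'ey' where, respectively, nothing, y, the coset x W_(lambda e),
   or both are prescribed; so each class has an explicit maximum and (except for H)
   an explicit minimum, obtained by making x' largest and y' smallest or conversely.
   If xey <=+ afb, a witness w can be traded for one adapted to these extremal
   elements, because u <= y implies u <= yv when u is minimal in u W_I and v is in
   W_I, while a maximal element of a W_I-coset absorbs W_I below itself; both follow
   from the lifting property, i.e. from the strong exchange condition, which comes
   from letting W act on W x {+1, -1} by signed conjugation. The sign - is reduced
   to + by the involution of the inverse monoid R, which exchanges L and R.
   For H the minimum really fails in the rook monoid of rank 2: with s the
   transposition and e = E_00, the H-class of se is {se} and that of 1 is {1, s}, and
   se <=+ s although se is not below 1. *)

Set Implicit Arguments.
Unset Strict Implicit.
Unset Printing Implicit Defensive.

Local Open Scope group_scope.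

(** * Bruhat order of a group with a reflection cocycle *)

(** The obstacle is the shape of the witness: it must stay in W_(lambda^* f) W_(lambda_* e), whereas
    moving inside a class multiplies x by elements of W_(lambda e). The two are reconciled by
    W_(lambda e) = W_(lambda^* e) W_(lambda_* e), with lambda^* increasing and lambda_* decreasing:
    the first factor goes into W_(lambda^* f), the second stays at e. For maxima the two
    inequalities decouple: minimality of b removes the W_(lambda^* f) part on the right, and the
    absorbing top of a coset takes care of the left. For minima they remain coupled: changing x
    changes w, hence w^-1 b. This is compensated by a free y (for J and R), or x is 1 and puts no
    condition on w (for L); H offers neither. The Bruhat order is studied in an abstract finite
    group with a length and an inversion cocycle, since the units of R are only a subset of a
    monoid. The universal property of the Coxeter presentation enters only to build that cocycle. *)

Definition refl_set (gT : finGroupType) (S : {set gT}) : {set gT} :=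
  [set w * s * w^-1 | w : gT in [set: gT], s : gT in S].

(** The intended [n u t] says that the reflection [t] is a left inversion of [u], see
    [cocycle_lenE]; the middle clause is the composition rule of inversion sets. *)
Definition refl_cocycle (gT : finGroupType) (S : {set gT}) (n : gT -> gT -> bool) :=
  [/\ {in S, forall s, s * s = 1},
      forall u v t, n (u * v) t = n u t (+) n v (t ^ u)
    & {in S, forall s t, n s t = (t == s)}].

Definition is_length (gT : finGroupType) (S : {set gT}) (len : gT -> nat) :=
  [/\ len 1 = 0%N,
      forall w, len w^-1 = len w,
      {in S, forall s w, (len (s * w)%g <= (len w).+1)%N}
    & forall w, w != 1 -> exists2 s, s \in S & len w = (len (s^-1 * w)%g).+1].

Definition bruhat_step (gT : finGroupType) (S : {set gT}) (len : gT -> nat) : rel gT :=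
  [rel u v | (u^-1 * v \in refl_set S) && (len u < len v)%N].

Section Bruhat.

Variables (gT : finGroupType) (S : {set gT}) (len : gT -> nat) (n : gT -> gT -> bool).
Hypotheses (nP : refl_cocycle S n) (lenP : is_length S len).
Implicit Types (s t u v w x y z : gT) (H K : {group gT}).

Local Notation step := (bruhat_step S len).
Local Notation le := (connect step).

Lemma gen_invol s : s \in S -> s^-1 = s.
Proof. by case: nP => ss _ _ /ss; move/(canRL (mulKg s)); rewrite mulg1. Qed.

Lemma refl_setP t :
  reflect (exists2 s, s \in S & exists w, t = w * s * w^-1) (t \in refl_set S).
Proof.
apply: (iffP imset2P) => [[w s _ sS ->]|[s sS [w ->]]]; first by exists s => //; exists w.
by exists w s.
Qed.

Lemma refl_setJ t u : t \in refl_set S -> t ^ u \in refl_set S.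
Proof.
case/refl_setP=> s sS [w ->]; apply/refl_setP; exists s => //; exists (u^-1 * w).
by rewrite conjgE invMg invgK !mulgA.
Qed.

Lemma refl_set_gen s : s \in S -> s \in refl_set S.
Proof. by move=> sS; apply/refl_setP; exists s => //; exists 1; rewrite mul1g invg1 mulg1. Qed.

Lemma refl_setV t : t \in refl_set S -> t^-1 = t.
Proof.
by case/refl_setP=> s sS [w ->]; rewrite !invMg invgK (gen_invol sS) mulgA.
Qed.

Lemma cocycle1 t : n 1 t = false.
Proof.
by case: nP => _ nM _; have := nM 1 1 t; rewrite mul1g conjg1; case: (n 1 t).
Qed.

(** Writing t = u s u^-1, the contributions of u and u^-1 cancel by the cocycle rule for u u^-1 = 1,
    and [n s s] remains. *)
Lemma cocycle_refl t : t \in refl_set S -> n t t.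
Proof.
case: nP => _ nM nS /refl_setP[s sS [u ->]]; set t' := u * s * u^-1.
have tu : t' ^ u = s by rewrite conjgE /t' !mulgA mulVg mul1g mulgKV.
have := nM u u^-1 t'; rewrite mulgV cocycle1 tu => e0.
have -> : n t' t' = n (u * s) t' (+) n u^-1 (t' ^ (u * s)) by rewrite -nM.
have ss : s ^ s = s by rewrite conjgE mulKg.
rewrite nM conjgM tu ss (nS s sS) eqxx; move: e0.
by case: (n u t'); case: (n u^-1 s).
Qed.

(** Strong exchange, by induction on length: strip a left descent s from w; either t = s, or [t ^ s]
    is an inversion of the shorter element. *)
Lemma cocycle_len w t : n w t -> (len (t * w)%g < len w)%N.
Proof.
case: nP lenP => ss nM nS [l1 lV lM lS].
have [k] := ubnP (len w); elim: k => // k IH in w t *; rewrite ltnS => lek.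
have [->|w1] := eqVneq w 1; first by rewrite cocycle1.
have [s sS e] := lS _ w1; have wE : w = s * (s^-1 * w) by rewrite mulKVg.
rewrite {1}wE nM (nS s sS); have [-> _|nts] := eqVneq t s.
  by rewrite e -[in X in len X](gen_invol sS) ltnSn.
move=> h; have := IH (s^-1 * w) (t ^ s) _ h; rewrite -e => /(_ lek) lt.
have -> : t * w = s * (t ^ s * (s^-1 * w)) by rewrite conjgE !mulgA mulgV mul1g mulgK.
by rewrite e ltnS; apply: leq_trans (lM _ sS _) _.
Qed.

(** For the converse, [n t t] makes [n w t] and [n (t * w) t] complementary, so [cocycle_len]
    applies to [t * w]. *)
Lemma cocycle_lenE w t : t \in refl_set S -> n w t = (len (t * w)%g < len w)%N.
Proof.
move=> tR; apply/idP/idP; first exact: cocycle_len.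
apply: contraLR => nn; rewrite -leqNgt ltnW //.
have <- : t * (t * w) = w by rewrite -{1}(refl_setV tR) mulKg.
have -> : t * (t * (t * w)) = t * w by rewrite -{1}(refl_setV tR) mulKg.
apply: cocycle_len; case: nP => _ nM _.
by rewrite nM cocycle_refl // conjgE mulKg (negPf nn).
Qed.

(* Conjugating the reflection by a generator preserves the direction of a
   Bruhat step, except for that generator itself. *)
Lemma len_conj_gen s t w : s \in S -> t \in refl_set S -> t != s ->
  (len (w * t * s)%g < len (w * s)%g)%N = (len (w * t)%g < len w)%N.
Proof.
move=> sS tR nts; case: nP lenP => ss nM nS [_ lV _ _].
rewrite -[len (w * t * s)%g]lV -[len (w * s)%g]lV -[len (w * t)%g]lV -[len w]lV.
rewrite !invMg (refl_setV tR) (gen_invol sS).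
have -> : s * (t * w^-1) = t ^ s * (s * w^-1)
  by rewrite conjgE (gen_invol sS) -!mulgA (mulgA s s) ss // mul1g.
rewrite -!cocycle_lenE ?refl_setJ // nM (nS s sS) -conjgM ss // conjg1.
suff /negPf-> : t ^ s != s by [].
by apply: contra nts => /eqP ts; rewrite -(conjgK s t) ts conjgE invgK mulgV mulg1.
Qed.

Lemma len_gen_neq s w : s \in S -> (len (w * s)%g < len w)%N = ~~ (len w < len (w * s)%g)%N.
Proof.
move=> sS; have sR := refl_set_gen sS; case: nP lenP => ss nM nS [_ lV _ _].
rewrite -[len (w * s)%g]lV -[len w]lV invMg (gen_invol sS) -cocycle_lenE //.
have -> : len w^-1 = len (s * (s * w^-1))%g by rewrite mulgA ss // mul1g.
by rewrite -cocycle_lenE // nM (nS s sS) eqxx conjgE mulKg negbK.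
Qed.

Lemma bruhat_step_mulr u v s : s \in S -> step u v -> u * s = v \/ step (u * s) (v * s).
Proof.
move=> sS /andP[tR lt]; have [ts|nts] := eqVneq (u^-1 * v) s; first by left; rewrite -ts mulKVg.
right; apply/andP; split.
  by have -> : (u * s)^-1 * (v * s) = (u^-1 * v) ^ s;
    [rewrite conjgE invMg !mulgA | apply: refl_setJ].
have vE : v * (u^-1 * v) = u by rewrite -(refl_setV tR) invMg invgK mulKVg.
have := len_conj_gen v sS tR nts; rewrite vE => ->.
exact: lt.
Qed.

(** Lifting property. Translate a chain from u to v by s: if one of its steps is along s, the
    translated chain rejoins the original one there; otherwise it ends at [v * s], which is below
    v. *)
Lemma bruhat_mulr_le u v s : s \in S -> le u v -> (len (v * s)%g < len v)%N -> le (u * s) v.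
Proof.
move=> sS /connectP[p]; elim: p u => [|u1 p IH] u /=.
  move=> _ -> lt; apply/connect1/andP; split=> //.
  by rewrite invMg -mulgA mulVg mulg1 (gen_invol sS) refl_set_gen.
case/andP=> st pth vE lt; have le1 := IH _ pth vE lt.
have [->|st'] := bruhat_step_mulr sS st; last exact: connect_trans (connect1 st') le1.
by apply/connectP; exists p.
Qed.

(** Dual lifting, with the chain unrolled from its top: it starts from u < [u * s], and a last step
    along s brings [v * s] back to the previous vertex. *)
Lemma bruhat_le_mulr u v s : s \in S -> le u v -> (len u < len (u * s)%g)%N -> le u (v * s).
Proof.
move=> sS /connectP[p pth ->] lt; elim/last_ind: p pth {v} => [|p v IH] /=.
  by move=> _; apply/connect1/andP; split=> //; rewrite mulKg refl_set_gen.
rewrite rcons_path last_rcons => /andP[pth st].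
have [<-|st'] := bruhat_step_mulr sS st; last exact: connect_trans (IH pth) (connect1 st').
rewrite -mulgA; case: nP => ss _ _; rewrite ss // mulg1.
by apply/connectP; exists p.
Qed.

Lemma bruhat_inv u v : le u v -> le u^-1 v^-1.
Proof.
case/connectP=> p; elim: p u => [|w p IH] u /=; first by move=> _ ->.
case/andP=> /andP[tR lt] pth vE; apply: connect_trans (IH _ pth vE).
apply/connect1/andP; case: lenP => _ lV _ _; split; last by rewrite !lV.
have -> : u^-1^-1 * w^-1 = ((u^-1 * w) ^ u^-1)^-1.
  by rewrite conjgE invgK -mulgA mulKVg invMg invgK.
by rewrite refl_setV refl_setJ.
Qed.

Lemma bruhat_len u v : le u v -> u = v \/ (len u < len v)%N.
Proof.
case/connectP=> p; elim: p u => [|w p IH] u /=; first by move=> _ ->; left.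
case/andP=> /andP[_ lt] pth /(IH _ pth) []; first by move=> <-; right.
by move/(ltn_trans lt); right.
Qed.

(** * Minimal and maximal elements of parabolic cosets *)

Definition left_min H u := [forall v in H, le u (u * v)].
Definition right_min H u := [forall v in H, le u (v * u)].

Lemma lmin_inv H u : left_min H u = right_min H u^-1.
Proof.
apply/forall_inP/forall_inP => h v vH.
  by rewrite -[v]invgK -invMg; apply/bruhat_inv/h; rewrite groupV.
by rewrite -[u]invgK -[v]invgK -invMg; apply/bruhat_inv/h; rewrite groupV.
Qed.

Section Parabolic.

Variable I : {set gT}.
Hypothesis IS : I \subset S.
Local Notation P := <<I>>%G.

Lemma parabolic_ind (Q : gT -> Prop) w : Q w ->
  (forall u s, s \in I -> Q u -> Q (u * s)) -> {in P, forall v, Q (w * v)}.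
Proof.
move=> Q1 QM v /gen_prodgP[k [c cI ->]].
elim: k c cI => [|k IH] c cI; first by rewrite big_ord0 mulg1.
by rewrite big_ord_recr /= mulgA; apply: QM => //; apply: (IH (fun i => c (widen_ord _ i))).
Qed.

Lemma lmin_le u y v : left_min P u -> le u y -> v \in P -> le u (y * v).
Proof.
move=> /forall_inP umin uy; move: v;
  apply: (parabolic_ind (Q := fun w => le u w)) => // w s sI uw.
have sS := subsetP IS _ sI; apply: bruhat_le_mulr => //.
have := umin s (mem_gen sI); case/bruhat_len => // us.
(* The case u = [u * s] would give s = 1, but [n s s] is true and [n 1 s] is false. *)
case: nP => ss _ nS; have := nS _ sS s; rewrite eqxx.
by have -> : s = 1 by [apply: (mulgI u); rewrite mulg1]; rewrite cocycle1.
Qed.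

Lemma coset_min w : exists2 v, v \in P & left_min P (w * v).
Proof.
have [v vP vmin] := arg_minnP (fun v => len (w * v)%g) (group1 P).
exists v => //; apply/forall_inP;
  apply: (parabolic_ind (Q := fun u => le (w * v) u)) => // u s sI uw.
have sS := subsetP IS _ sI; apply: bruhat_le_mulr => //.
have : (len (w * v)%g <= len (w * v * s)%g)%N.
  by rewrite -mulgA; apply: vmin; apply: (groupM vP (mem_gen sI)).
by rewrite leqNgt len_gen_neq // negbK.
Qed.

(** A longest element of the coset has every generator of I as a right descent, so lifting applies
    repeatedly. Absorption of whatever lies below, rather than mere maximality in the coset, is what
    the comparison of maxima uses. *)
Lemma coset_max w :
  exists2 v, v \in P & forall u, le u (w * v) -> {in P, forall v', le (u * v') (w * v)}.
Proof.
have [v vP vmax] := arg_maxnP (fun v => len (w * v)%g) (group1 P).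
exists v => // u leu; apply: (parabolic_ind (Q := fun u => le u (w * v))) => // u0 s sI leu0.
have sS := subsetP IS _ sI; apply: bruhat_mulr_le => //.
have : (len (w * v * s)%g <= len (w * v)%g)%N.
  by rewrite -mulgA; apply: vmax; apply: (groupM vP (mem_gen sI)).
by rewrite leqNgt -len_gen_neq.
Qed.

Lemma rmin_le u y v : right_min P u -> le u y -> v \in P -> le u (v * y).
Proof.
rewrite -[u]invgK -lmin_inv => h uy vP; rewrite -[v * y]invgK.
apply: bruhat_inv; rewrite invMg; apply: lmin_le; rewrite ?groupV //.
by rewrite -[u^-1]invgK; apply: bruhat_inv.
Qed.

Lemma rcoset_min w : exists2 v, v \in P & right_min P (v * w).
Proof.
have [v vP h] := coset_min w^-1; exists v^-1; rewrite ?groupV //.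
by move: h; rewrite lmin_inv invMg invgK.
Qed.

End Parabolic.

(** For I = S there is only one coset, and its longest element absorbs the whole group. *)
Lemma bruhat_top : <<S>> = [set: gT] -> exists w0, forall u, le u w0.
Proof.
move=> gS; have [v _ vmax] := coset_max (subxx S) 1; exists v => u.
have := vmax (1 * v) (connect0 _ _) (v^-1 * u); rewrite !mul1g mulKVg; apply.
by rewrite /= gS inE.
Qed.

End Bruhat.

(** * The group of units *)

Lemma unit_groupP (R : finMonoidType) (w : R) :
  reflect (exists v, w * v = 1 /\ v * w = 1) (w \in unit_group R).
Proof.
rewrite inE; apply: (iffP existsP) => -[v].
  by case/andP=> /eqP ? /eqP ?; exists v.
by case=> /eqP wv /eqP vw; exists v; rewrite wv.
Qed.

Lemma unit_group1 (R : finMonoidType) : 1 \in unit_group R.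
Proof. by apply/unit_groupP; exists 1; rewrite mul1g. Qed.

Lemma unit_groupM (R : finMonoidType) (v w : R) :
  v \in unit_group R -> w \in unit_group R -> v * w \in unit_group R.
Proof.
case/unit_groupP=> v' [vv' v'v] /unit_groupP[w' [ww' w'w]]; apply/unit_groupP; exists (w' * v').
by rewrite !mulgA -(mulgA v) ww' -(mulgA w') v'v !mulg1.
Qed.

Lemma uinvP (R : finMonoidType) (w : R) :
  w \in unit_group R -> w * uinv w = 1 /\ uinv w * w = 1.
Proof.
rewrite /uinv inE; case: pickP => [v /andP[/eqP-> /eqP->] // | nov /existsP[v]].
by rewrite nov.
Qed.

Lemma uinv_unit (R : finMonoidType) (w : R) : w \in unit_group R -> uinv w \in unit_group R.
Proof. by case/uinvP=> h1 h2; apply/unit_groupP; exists w. Qed.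

(** In R the map [uinv] inverts units only; on this subtype it is a genuine group inverse, so that
    the abstract Bruhat theory applies. *)
Definition unit_type (R : finMonoidType) := {w : R | w \in unit_group R}.

Section UnitGroup.

Variable R : finMonoidType.
Implicit Types u v w : unit_type R.

HB.instance Definition _ := Finite.on (unit_type R).
HB.instance Definition _ := SubType.on (unit_type R).

Definition unit_mul u v : unit_type R := exist _ (val u * val v) (unit_groupM (valP u) (valP v)).
Definition unit_one : unit_type R := exist _ 1 (unit_group1 R).
Definition unit_inv u : unit_type R := exist _ (uinv (val u)) (uinv_unit (valP u)).

Fact unit_mulA : associative unit_mul.
Proof. by move=> u v w; apply/val_inj/mulgA. Qed.

Fact unit_mul1 : left_id unit_one unit_mul.
Proof. by move=> u; apply/val_inj/mul1g. Qed.

Fact unit_mulV : left_inverse unit_one unit_inv unit_mul.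
Proof. by move=> u; apply: val_inj; case: (uinvP (valP u)). Qed.

HB.instance Definition _ := Finite_isGroup.Build (unit_type R) unit_mulA unit_mul1 unit_mulV.

Lemma val_unit1 : val (1 : unit_type R) = 1. Proof. by []. Qed.
Lemma val_unitM u v : val (u * v) = val u * val v. Proof. by []. Qed.
Lemma val_unitV u : val u^-1 = uinv (val u). Proof. by []. Qed.

Lemma val_unitX u n : val (u ^+ n) = val u ^+ n.
Proof. by elim: n => // n IH; rewrite !expgS -IH. Qed.

Lemma val_unitK u x : val u^-1 * (val u * x) = x.
Proof. by rewrite mulgA -val_unitM mulVg mul1g. Qed.

Lemma val_unitVK u x : val u * (val u^-1 * x) = x.
Proof. by rewrite mulgA -val_unitM mulgV mul1g. Qed.

Lemma val_unitKr u x : x * val u * val u^-1 = x.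
Proof. by rewrite -mulgA -val_unitM mulgV mulg1. Qed.

Lemma val_unitVKr u x : x * val u^-1 * val u = x.
Proof. by rewrite -mulgA -val_unitM mulVg mulg1. Qed.

Lemma unit_groupW (w : R) : w \in unit_group R -> exists u, w = val u.
Proof. by move=> wU; exists (exist _ w wU). Qed.

Definition unit_set (A : {set R}) : {set unit_type R} := [set u | val u \in A].

Lemma is_subgroupP (A : {set R}) :
  reflect [/\ A \subset unit_group R, 1 \in A, {in A &, forall x y, x * y \in A}
             & {in A, forall x, uinv x \in A}] (is_subgroup A).
Proof.
apply: (iffP and4P) => -[AU A1 AM AV]; split=> //.
- by move=> x y xA yA; move/forall_inP/(_ x xA)/forall_inP/(_ y yA): AM.
- by apply/forall_inP.
- by apply/forall_inP=> x xA; apply/forall_inP=> y yA; apply: AM.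
- by apply/forall_inP.
Qed.

Lemma genP (I : {set R}) u :
  I \subset unit_group R -> (val u \in gen I) = (u \in <<unit_set I>>).
Proof.
move=> IU; apply/bigcapP/idP => [h|uI A /andP[/is_subgroupP[_ A1 AM _] IA]].
  pose A := [set val v | v in <<unit_set I>>].
  suff /h/imsetP[v vI /val_inj->] : is_subgroup A && (I \subset A) by [].
  apply/andP; split; last first.
    apply/subsetP=> x xI; have [v vE] := unit_groupW (subsetP IU x xI).
    by apply/imsetP; exists v => //; apply: mem_gen; rewrite inE -vE.
  apply/is_subgroupP; split.
  - by apply/subsetP=> _ /imsetP[v _ ->]; apply: valP.
  - by apply/imsetP; exists 1; rewrite ?group1.
  - by move=> _ _ /imsetP[v vI ->] /imsetP[w wI ->]; apply/imsetP; exists (v * w);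
    rewrite ?groupM.
  - by move=> _ /imsetP[v vI ->]; apply/imsetP; exists v^-1; rewrite ?groupV.
have gA : group_set (unit_set A).
  by apply/group_setP; split=> [|v w]; rewrite !inE //; apply: AM.
suff /subsetP/(_ u uI) : <<unit_set I>> \subset Group gA by rewrite inE.
rewrite gen_subG; apply/subsetP=> v; rewrite !inE; exact: (subsetP IA).
Qed.

End UnitGroup.

(** * Length, reflections and Bruhat order seen in the group of units *)

Section Transfer.

Variables (R : finMonoidType) (S : {set R}).
Hypothesis coxS : coxeter_system S.
Local Notation gT := (unit_type R).
Local Notation SG := (unit_set S).
Local Notation len := (fun u : gT => clength S (val u)).

Lemma gens_unit : S \subset unit_group R.
Proof. by case: coxS. Qed.

Lemma gens_gen : <<SG>> = [set: gT].
Proof.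
by case: coxS => SU gS _; apply/setP=> u; rewrite -genP // gS in_setT (valP u).
Qed.

Lemma gens_invol s : s \in SG -> s * s = 1.
Proof.
case: coxS => _ _ [m [[m1 _ _] mS _]]; rewrite inE => sS; apply: val_inj.
by rewrite -[RHS](mS _ _ sS sS) m1 // expg1.
Qed.

Lemma gens_inv s : s \in SG -> s^-1 = s.
Proof. by move/gens_invol/(canRL (mulKg s)); rewrite mulg1. Qed.

Lemma wordsP (u : gT) k : (val u \in words S k) = (u \in SG ^+ k).
Proof.
elim: k u => [|k IH] u; first by rewrite expg0 !inE.
rewrite expgSr; apply/imset2P/mulsgP => [[x s xk sS uE]|[x s xk sS ->]].
  have [s' sE] := unit_groupW (subsetP gens_unit s sS).
  exists (u * s'^-1) s'; rewrite ?mulgKV ?inE -?sE //.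
  rewrite -IH val_unitM uE sE val_unitKr; exact: xk.
by exists (val x) (val s); rewrite ?IH //; rewrite inE in sS.
Qed.

(** [clength] searches only below [#|R|]. The bound holds because a repetition-free path from 1 to u
    in the Cayley graph has at most as many vertices as there are units. *)
Lemma words_short (u : gT) : exists2 k, (k < #|R|)%N & u \in SG ^+ k.
Proof.
pose e := [rel x y : gT | x^-1 * y \in SG].
have path_words p x : path e x p -> x^-1 * last x p \in SG ^+ size p.
  elim: p x => [|y p IH] x /=; first by rewrite mulVg inE.
  case/andP=> xy /IH h; rewrite -(mulKVg y (last y p)) mulgA expgS.
  exact: mem_mulg.
have cu : connect e 1 u.
  have : u \in <<SG>> by rewrite gens_gen inE.
  case/gen_prodgP=> k [c cS ->]; elim: k c cS => [|k IH] c cS; first by rewrite big_ord0.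
  rewrite big_ord_recr /=; apply: connect_trans (IH (fun i => c (widen_ord _ i)) _) _ => //.
  by apply: connect1; rewrite /= mulKg.
case/connectP: cu => p pth ->; case: (shortenP pth) => p' pth' up' _.
exists (size p'); last by have := path_words _ _ pth'; rewrite invg1 mul1g.
rewrite -[(size p').+1]/(size (1 :: p')) -(card_uniqP up').
apply: leq_trans (max_card _) _; exact: leq_card val_inj.
Qed.

Lemma clength_le (u : gT) k : u \in SG ^+ k -> (len u <= k)%N.
Proof.
rewrite -wordsP => uk; rewrite leqNgt; apply/negP=> lt.
have kR : (k < #|R|)%N.
  by apply: leq_trans lt _; rewrite -[leqRHS](size_iota 0) find_size.
by have := before_find 0%N lt; rewrite nth_iota // add0n uk.
Qed.

Lemma clength_words (u : gT) : u \in SG ^+ len u.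
Proof.
rewrite -wordsP; have [k kR uk] := words_short u.
have h : has (fun k => val u \in words S k) (iota 0 #|R|).
  by apply/hasP; exists k; rewrite ?mem_iota ?wordsP.
have := nth_find 0%N h; rewrite nth_iota ?add0n //.
by rewrite -[ltnRHS](size_iota 0) -has_find.
Qed.

Lemma clengthP : is_length SG len.
Proof.
have lenV_le u : (len u^-1 <= len u)%N.
  apply: clength_le; have SV : SG^-1 = SG.
    by apply/setP=> s; rewrite inE; apply/idP/idP => sS; have := gens_inv sS;
      rewrite ?invgK => e; rewrite // e // -e.
  by rewrite -[SG]SV expgVn mem_invg invgK clength_words.
split.
- by apply/eqP; rewrite -leqn0; apply: clength_le; rewrite inE.
- by move=> w; apply/eqP; rewrite eqn_leq lenV_le -{1}[w]invgK lenV_le.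
- by move=> s sS w; apply: clength_le; rewrite expgS mem_mulg ?clength_words.
move=> w w1; have := clength_words w; case lE: (len w) => [|k]; first by rewrite inE (negPf w1).
rewrite expgS => /mulsgP[s w' sS wk wE]; exists s => //.
rewrite -lE; apply/eqP; rewrite eqn_leq; apply/andP; split.
  by rewrite -{1}(mulKVg s w); apply: clength_le; rewrite expgS mem_mulg ?clength_words.
by rewrite lE ltnS wE mulKg clength_le.
Qed.

Lemma reflectionsP (t : gT) : (val t \in reflections S) = (t \in refl_set SG).
Proof.
apply/imset2P/imset2P => [[w s wU sS tE]|[w s _ sS ->]].
  have [w' wE] := unit_groupW wU; have [s' sE] := unit_groupW (subsetP gens_unit s sS).
  exists w' s'; rewrite ?inE -?sE //; apply: val_inj.
  by rewrite tE wE sE.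
by exists (val w) (val s); rewrite ?(valP w) //; rewrite inE in sS.
Qed.

Lemma reflections_unit (t : R) : t \in reflections S -> t \in unit_group R.
Proof.
case/imset2P=> w s wU sS ->; rewrite !unit_groupM ?uinv_unit //.
exact: (subsetP gens_unit).
Qed.

Lemma bruhatE (u v : gT) : bruhat S (val u) (val v) = connect (bruhat_step SG len) u v.
Proof.
apply/connectP/idP => [[p]|/connectP[p]].
  elim: p u => [|x p IH] u /=; first by move=> _ /val_inj->.
  case/andP=> /andP[/existsP[t /andP[tR /eqP xE]] lt] pth vE.
  have [t' tE] := unit_groupW (reflections_unit tR).
  have x'E : x = val (u * t') by rewrite xE tE.
  rewrite x'E in pth vE lt; apply: connect_trans (IH _ pth vE).
  by apply/connect1/andP; rewrite mulKg -reflectionsP -tE.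
move=> pth vE; exists (map val p); last by rewrite last_map -vE.
elim: p u pth {vE} => //= w p IH u /andP[/andP[tR lt] pth].
rewrite IH // andbT /= lt andbT; apply/existsP; exists (val (u^-1 * w)).
by rewrite reflectionsP tR val_unitM val_unitVK /=.
Qed.

End Transfer.

(** * The reflection cocycle of a Coxeter system *)

Section ReflectionAction.

Variables (gT : finGroupType) (S : {set gT}).
Hypothesis S_invol : {in S, forall s, s * s = 1}.
Implicit Types s t : gT.

(** The Boolean is the sign, flipped exactly at the reflection s itself. Acting trivially outside S
    makes this an involution, hence a permutation, for every argument. *)
Definition refl_act s (p : gT * bool) : gT * bool :=
  if s \in S then (p.1 ^ s, p.2 (+) (p.1 == s)) else p.

Lemma refl_actK s : involutive (refl_act s).
Proof.
rewrite /refl_act => -[t b]; case sS: (s \in S) => //=; rewrite -conjgM S_invol // conjg1.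
by rewrite (can2_eq (conjgK s) (conjgKV s)) conjgE invgK mulgV mulg1 addbK.
Qed.

Definition refl_perm s : {perm gT * bool} := perm (inv_inj (refl_actK s)).

Lemma refl_permE s t b : s \in S -> refl_perm s (t, b) = (t ^ s, b (+) (t == s)).
Proof. by move=> sS; rewrite permE /refl_act sS. Qed.

(* The reflections crossed by the word (s s')^k are c^j s for j < 2k, where
   c = s s'; this sequence has period m once c^m = 1. *)
Lemma refl_perm_braid s s' m : s \in S -> s' \in S -> (s * s') ^+ m = 1 ->
  (refl_perm s * refl_perm s') ^+ m = 1.
Proof.
move=> sS s'S; set c := s * s' => cm.
have sV : s^-1 = s by rewrite -[RHS](mulKg s) S_invol // mulg1.
have s'V : s'^-1 = s' by rewrite -[RHS](mulKg s') S_invol // mulg1.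
have flip i : s * c ^- i = c ^+ i * s.
  have : (c ^- 1) ^ s = c by rewrite expg1 /c invMg sV s'V conjgE sV -mulgA S_invol // mulg1.
  move/(congr1 (fun x => x ^+ i)); rewrite -conjXg expg1 conjgE sV -expgVn => <-.
  by rewrite -mulgA -mulgA S_invol // mulg1.
have evenE i t : (t ^ (c ^+ i) == s) = (t == c ^+ i.*2 * s).
  rewrite (can2_eq (conjgK _) (conjgKV _)) conjgE invgK flip mulgA -expgD addnn.
  by [].
have oddE i t : (t ^ (c ^+ i * s) == s') = (t == c ^+ i.*2.+1 * s).
  rewrite (can2_eq (conjgK _) (conjgKV _)) conjgE invgK invMg sV.
  have -> : c ^+ i * s * (s' * (s * c ^- i)) = c ^+ i * c * c ^+ i * s by rewrite flip /c !mulgA.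
  by rewrite -expgSr -expgD addSn addnn.
pose f t j := nat_of_bool (t == c ^+ j * s).
have powE k t b : ((refl_perm s * refl_perm s') ^+ k) (t, b)
    = (t ^ (c ^+ k), b (+) odd (\sum_(0 <= j < k.*2) f t j)).
  elim: k => [|k IH]; first by rewrite big_geq // addbF perm1 conjg1.
  rewrite expgSr permM IH permM !refl_permE // expgSr -!conjgM.
  rewrite evenE oddE doubleS !big_nat_recr //= !oddD !oddb -!addbA.
  by [].
(* The sign flips are counted by a sum over 2m indices whose two halves agree by periodicity, so
   their number is even. *)
apply/permP=> -[t b]; rewrite perm1 powE cm conjg1 -addnn; congr (_, _).
rewrite (big_cat_nat (n := m)) ?leq_addr //= -{2}[m]add0n big_addn addnK.
rewrite [X in _ + X](eq_bigr (f t)) => [|j _]; first by rewrite addnn odd_double addbF.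
by rewrite /f expgD cm mulg1.
Qed.

End ReflectionAction.

(** The braid relations hold for the signed conjugations, so the presentation extends them to an
    action of the whole group; the cocycle is the sign this action gives to (t, [false]). *)
Lemma coxeter_cocycle (R : finMonoidType) (S : {set R}) :
  coxeter_system S -> exists n, refl_cocycle (unit_set S) n.
Proof.
move=> coxS; have S_invol := gens_invol coxS; case: (coxS) => SU _ [m [_ mS univ]].
(* The universal property asks for a map on all of R: [insubd] sends non-units to 1, and only the
   values on S matter. *)
pose h (x : R) : {perm unit_type R * bool} := refl_perm S_invol (insubd (1 : unit_type R) x).
have hE s : s \in unit_set S -> h (val s) = refl_perm S_invol s by rewrite /h valKd.
have [x y xS yS|phi phiM phiS] := univ {perm unit_type R * bool} h.
  have [s sE] := unit_groupW (subsetP SU x xS); have [s' s'E] := unit_groupW (subsetP SU y yS).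
  have [sS s'S] : s \in unit_set S /\ s' \in unit_set S by rewrite !inE -sE -s'E.
  rewrite sE s'E !hE //; apply: refl_perm_braid => //.
  by apply: val_inj; rewrite val_unitX val_unitM -sE -s'E mS.
have phiGM (u v : unit_type R) : phi (val (u * v)) = phi (val u) * phi (val v).
  by rewrite -phiM ?(valP u) ?(valP v).
have phiGS s : s \in unit_set S -> phi (val s) = refl_perm S_invol s.
  by move=> sS; rewrite -hE // phiS //; rewrite inE in sS.
have phi1 : phi (val (1 : unit_type R)) = 1.
  by apply: (mulgI (phi (val (1 : unit_type R)))); rewrite -phiGM !mulg1.
pose n (u t : unit_type R) := (phi (val u) (t, false)).2.
(* Each generator commutes with the global change of sign, hence so does the action; its first
   component is conjugation. *)
have nE u t b : phi (val u) (t, b) = (t ^ u, b (+) n u t).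
  have uS : u \in <<unit_set S>> by rewrite gens_gen // in_setT.
  pose Q (v : unit_type R) := forall t b, phi (val v) (t, b) = (t ^ v, b (+) n v t).
  have Q1 : Q 1 by move=> t' b'; rewrite /n phi1 !perm1 conjg1 addbF.
  rewrite -[u]mul1g; apply: (parabolic_ind (Q := Q) Q1 _ uS) => v s sS IH t' b'.
  by rewrite /n phiGM !permM !IH phiGS // !refl_permE // conjgM addFb addbA.
exists n; split=> // [u v t|s sS t].
  by rewrite {1}/n phiGM permM nE nE addFb.
by rewrite /n phiGS // refl_permE.
Qed.

(** * Parabolic subgroups attached to idempotents *)

Section RennerCoxeter.

Variables (R : finMonoidType) (L S : {set R}).
Hypothesis RC : renner_coxeter L S.
Local Notation gT := (unit_type R).
Local Notation SG := (unit_set S).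
Implicit Types (e f r t : R) (a b u v w x y z : gT) (H K : {set gT}).

Let coxS : coxeter_system S := rc_coxeter RC.
Definition ubruhat u v := bruhat S (val u) (val v).
Local Notation le := ubruhat.
Local Notation clen := (fun u : gT => clength S (val u)).

Lemma ubruhatE u v : le u v = connect (bruhat_step SG clen) u v.
Proof. exact: bruhatE. Qed.

Definition lminimal H x := forall v, v \in H -> le x (x * v).
Definition rminimal H y := forall v, v \in H -> le y (v * y).
Definition parabolic H := exists2 I : {set gT}, I \subset SG & H = <<I>>.

Lemma ubruhat_refl u : le u u. Proof. exact: connect0. Qed.

Lemma ubruhat_trans v u w : le u v -> le v w -> le u w.
Proof. exact: connect_trans. Qed.

Lemma ubruhat_inv u v : le u v -> le u^-1 v^-1.
Proof.
have [n nP] := coxeter_cocycle coxS.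
rewrite !ubruhatE; exact: bruhat_inv nP (clengthP coxS) _ _.
Qed.

Lemma lminimalE (H : {group gT}) x : left_min SG clen H x <-> lminimal H x.
Proof.
split=> [/forall_inP h v /h|h]; first by rewrite ubruhatE.
by apply/forall_inP=> v /h; rewrite ubruhatE.
Qed.

Lemma rminimalE (H : {group gT}) x : right_min SG clen H x <-> rminimal H x.
Proof.
split=> [/forall_inP h v /h|h]; first by rewrite ubruhatE.
by apply/forall_inP=> v /h; rewrite ubruhatE.
Qed.

Lemma lminimal_le H u y v : parabolic H -> lminimal H u -> le u y -> v \in H -> le u (y * v).
Proof.
have [n nP] := coxeter_cocycle coxS.
case=> I IS -> /lminimalE h; rewrite !ubruhatE.
exact: (lmin_le nP (clengthP coxS) IS h).
Qed.

Lemma rminimal_le H u y v : parabolic H -> rminimal H u -> le u y -> v \in H -> le u (v * y).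
Proof.
have [n nP] := coxeter_cocycle coxS.
case=> I IS -> /rminimalE h; rewrite !ubruhatE.
exact: (rmin_le nP (clengthP coxS) IS h).
Qed.

Lemma lminimal_ex H w : parabolic H -> exists2 v, v \in H & lminimal H (w * v).
Proof.
have [n nP] := coxeter_cocycle coxS.
case=> I IS ->; have [v vI /lminimalE h] := coset_min nP (clengthP coxS) IS w.
by exists v.
Qed.

Lemma rminimal_ex H w : parabolic H -> exists2 v, v \in H & rminimal H (v * w).
Proof.
have [n nP] := coxeter_cocycle coxS.
case=> I IS ->; have [v vI /rminimalE h] := rcoset_min nP (clengthP coxS) IS w.
by exists v.
Qed.

Lemma coset_max_ex H w : parabolic H -> exists2 v, v \in H &
  forall u, le u (w * v) -> forall v', v' \in H -> le (u * v') (w * v).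
Proof.
have [n nP] := coxeter_cocycle coxS.
case=> I IS ->; have [v vI h] := coset_max nP (clengthP coxS) IS w.
exists v => // u; rewrite !ubruhatE => /h h' v' /h'.
by rewrite -ubruhatE.
Qed.

Lemma ubruhat_top : exists w0, forall u, le u w0.
Proof.
have [n nP] := coxeter_cocycle coxS.
have [w0 h] := bruhat_top nP (clengthP coxS) (gens_gen coxS).
by exists w0 => u; rewrite ubruhatE.
Qed.

(** The whole group, as a coset of itself, has a minimum; being below 1, which has length 0, it
    equals 1. *)
Lemma ubruhat_ge1 u : le 1 u.
Proof.
have [n nP] := coxeter_cocycle coxS; have lenP := clengthP coxS.
have [v _ /lminimalE vmin] := coset_min nP lenP (subxx SG) 1.
have vle w : le v w.
  by rewrite -(mulKVg v w) -{1}(mul1g v) -[X in le _ (X * _)](mul1g v) vmin //= gens_gen ?in_setT.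
have := vle 1; rewrite ubruhatE => /bruhat_len[<- //|].
by case: lenP => -> _ _ _; rewrite ltn0.
Qed.

Lemma ubruhat_le1 u : le u 1 -> u = 1.
Proof.
have [n nP] := coxeter_cocycle coxS; rewrite ubruhatE => /bruhat_len[//|].
by case: (clengthP coxS) => -> _ _ _; rewrite ltn0.
Qed.

(** * Centralisers and stabilisers of idempotents as parabolic subgroups *)

Definition ucentg e : {set gT} := [set u | val u * e == e * val u].
Definition ustabg e : {set gT} := [set u | (val u * e == e) && (e * val u == e)].
Definition upg e : {set gT} := <<unit_set (lambda_up S e)>>.

Lemma ucentP e u : reflect (val u * e = e * val u) (u \in ucentg e).
Proof. by rewrite inE; apply: eqP. Qed.

Lemma ustabP e u : reflect (val u * e = e /\ e * val u = e) (u \in ustabg e).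
Proof. by rewrite inE; apply: (iffP andP) => -[/eqP h1 /eqP h2]. Qed.

Fact ucent_group_set e : group_set (ucentg e).
Proof.
apply/group_setP; split=> [|u v /ucentP ue /ucentP ve]; apply/ucentP.
  by rewrite val_unit1 mul1g mulg1.
by rewrite val_unitM -mulgA ve mulgA ue mulgA.
Qed.
Canonical ucent_group e := Group (ucent_group_set e).

Fact ustab_group_set e : group_set (ustabg e).
Proof.
apply/group_setP; split=> [|u v /ustabP[ue eu] /ustabP[ve ev]]; apply/ustabP.
  by rewrite val_unit1 mul1g mulg1.
by rewrite val_unitM -mulgA ve ue mulgA eu ev.
Qed.
Canonical ustab_group e := Group (ustab_group_set e).
Canonical upg_group e := [group of upg e].

Lemma ustab_normal e : ustabg e <| ucentg e.
Proof.
apply/normalP; split=> [|u /ucentP ue].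
  by apply/subsetP=> u /ustabP[h1 h2]; apply/ucentP; rewrite h1 h2.
apply/eqP; rewrite eqEcard cardJg leqnn andbT; apply/subsetP=> _ /imsetP[v /ustabP[h1 h2] ->].
have uVe : val u^-1 * e = e * val u^-1.
  by rewrite -{1}(val_unitKr u e) -ue mulgA val_unitK.
apply/ustabP; rewrite conjgE !val_unitM; split.
  by rewrite -!mulgA ue (mulgA (val v)) h1 -ue val_unitK.
by rewrite !mulgA -uVe -(mulgA _ e) h2 uVe val_unitVKr.
Qed.

Lemma std_parabolicP (A : {set R}) : is_std_parabolic S A ->
  parabolic_type S A \subset S /\ gen (parabolic_type S A) = A.
Proof.
case=> I IS gI; rewrite /parabolic_type; case: pickP => [J /andP[JS /eqP]//|/(_ I)].
by rewrite IS gI eqxx.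
Qed.

Lemma unit_setS (A B : {set R}) : A \subset B -> unit_set A \subset unit_set B.
Proof. by move=> /subsetP AB; apply/subsetP=> u; rewrite !inE => /AB. Qed.

Lemma sub_unit (A : {set R}) : A \subset S -> A \subset unit_group R.
Proof. by move=> AS; apply: subset_trans AS (gens_unit coxS). Qed.

Lemma lambda_gen e u : e \in L -> (val u \in gen (lambda S e)) = (u \in ucentg e).
Proof. by move/(rc_ucent RC)/std_parabolicP=> [_ ->]; rewrite [LHS]inE (valP u) inE. Qed.

Lemma lambda_down_gen e u : e \in L -> (val u \in gen (lambda_down S e)) = (u \in ustabg e).
Proof. by move/(rc_ustab RC)/std_parabolicP=> [_ ->]; rewrite [LHS]inE (valP u) inE. Qed.

Lemma lambda_up_gen e u : (val u \in gen (lambda_up S e)) = (u \in upg e).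
Proof.
by rewrite genP // sub_unit //; apply/subsetP=> s; rewrite inE => /andP[].
Qed.

Lemma ucent_parabolic e : e \in L -> parabolic (ucentg e).
Proof.
move=> eL; have [IS gI] := std_parabolicP (rc_ucent RC eL).
exists (unit_set (lambda S e)); first exact: unit_setS.
by apply/setP=> u; rewrite -genP ?sub_unit // -lambda_gen.
Qed.

Lemma ustab_parabolic e : e \in L -> parabolic (ustabg e).
Proof.
move=> eL; have [IS gI] := std_parabolicP (rc_ustab RC eL).
exists (unit_set (lambda_down S e)); first exact: unit_setS.
by apply/setP=> u; rewrite -genP ?sub_unit // -lambda_down_gen.
Qed.

Lemma sub_gen_unit (A : {set R}) (r : R) : A \subset S -> r \in gen A -> r \in unit_group R.
Proof.
move=> AS /bigcapP/(_ (unit_group R)); apply; rewrite sub_unit // andbT.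
apply/is_subgroupP; split=> //; first exact: unit_group1.
  by move=> x y; apply: unit_groupM.
by move=> x; apply: uinv_unit.
Qed.

(* W_(lambda e) is generated by lambda^* e and the normal subgroup W_(lambda_* e). *)
Lemma ucent_decomp e u : e \in L -> u \in ucentg e ->
  exists2 v, v \in upg e & exists2 w, w \in ustabg e & u = v * w.
Proof.
move=> eL; have [I IS CI] := ucent_parabolic eL; rewrite {1}CI => uI.
pose Q (u : gT) := exists2 v, v \in upg e & exists2 w, w \in ustabg e & u = v * w.
suff : Q (1 * u) by rewrite mul1g.
apply: (parabolic_ind (Q := Q) _ _ uI).
  by exists 1; rewrite ?group1 //; exists 1; rewrite ?group1 ?mulg1.
move=> _ s sI [v vU [w wD ->]].
have sC : s \in ucentg e by rewrite CI mem_gen.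
have [sD|nsD] := boolP (s \in ustabg e).
  by exists v => //; exists (w * s); rewrite ?groupM ?mulgA.
exists (v * s); last first.
  by exists (w ^ s); rewrite ?memJ_norm ?(subsetP (normal_norm (ustab_normal e))) // conjgE
    !mulgA mulgK.
rewrite groupM // mem_gen //; rewrite !inE in sC nsD *.
have := subsetP IS s sI; rewrite inE => ->; rewrite sC /=.
by apply: contra nsD => /eqP se; rewrite -(eqP sC) se eqxx.
Qed.

Lemma up_sub_ucent e : upg e \subset ucentg e.
Proof.
rewrite gen_subG; apply/subsetP=> s; rewrite !inE => /andP[_ /andP[]] //.
Qed.

Lemma idem_in_L e : e \in L -> e * e = e.
Proof. by move/(subsetP (rc_lattice_sub RC)); rewrite inE => /eqP. Qed.

Lemma ustabS e f : idem_le e f -> ustabg f \subset ustabg e.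
Proof.
case/andP=> /eqP ef /eqP fe; apply/subsetP=> u /ustabP[uf fu].
by apply/ustabP; split; [rewrite -{1}fe mulgA uf | rewrite -{1}ef -mulgA fu].
Qed.

Lemma upS e f : e \in L -> f \in L -> idem_le e f -> upg e \subset upg f.
Proof. by move=> eL fL ef; apply/genS/unit_setS/(rc_lambda_up RC). Qed.

(** * Left standard forms and the order + inside the group of units *)

Definition lstd r x e y :=
  [/\ r = val x * e * val y, e \in L, lminimal (ustabg e) x & rminimal (ucentg e) y].

(** The two factors of the witness are kept apart because later arguments discard or replace them
    separately. *)
Definition plus_le x e y a f b :=
  idem_le e f /\ exists w1 w2, [/\ w1 \in upg f, w2 \in ustabg e,
     le x (a * (w1 * w2)) & le ((w1 * w2)^-1 * b) y].

Lemma lmin_repsP (I : {set R}) H x : I \subset S ->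
  (forall u, (val u \in gen I) = (u \in H)) -> val x \in lmin_reps S I <-> lminimal H x.
Proof.
move=> IS IH; rewrite inE (valP x); split=> [/forall_inP h v vH|h].
  by apply: h; rewrite IH.
apply/forall_inP=> v vI; have [v' vE] := unit_groupW (sub_gen_unit IS vI).
by rewrite vE; apply: h; rewrite -IH -vE.
Qed.

Lemma rmin_repsP (I : {set R}) H x : I \subset S ->
  (forall u, (val u \in gen I) = (u \in H)) -> val x \in rmin_reps S I <-> rminimal H x.
Proof.
move=> IS IH; rewrite inE (valP x); split=> [/forall_inP h v vH|h].
  by apply: h; rewrite IH.
apply/forall_inP=> v vI; have [v' vE] := unit_groupW (sub_gen_unit IS vI).
by rewrite vE; apply: h; rewrite -IH -vE.
Qed.

Lemma lmin_lambda_down e x : e \in L ->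
  val x \in lmin_reps S (lambda_down S e) <-> lminimal (ustabg e) x.
Proof.
move=> eL; apply: lmin_repsP => [|u]; last exact: lambda_down_gen.
by have [] := std_parabolicP (rc_ustab RC eL).
Qed.

Lemma rmin_lambda_down e x : e \in L ->
  val x \in rmin_reps S (lambda_down S e) <-> rminimal (ustabg e) x.
Proof.
move=> eL; apply: rmin_repsP => [|u]; last exact: lambda_down_gen.
by have [] := std_parabolicP (rc_ustab RC eL).
Qed.

Lemma lmin_lambda e x : e \in L -> val x \in lmin_reps S (lambda S e) <-> lminimal (ucentg e) x.
Proof.
move=> eL; apply: lmin_repsP => [|u]; last exact: lambda_gen.
by have [] := std_parabolicP (rc_ucent RC eL).
Qed.

Lemma rmin_lambda e x : e \in L -> val x \in rmin_reps S (lambda S e) <-> rminimal (ucentg e) x.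
Proof.
move=> eL; apply: rmin_repsP => [|u]; last exact: lambda_gen.
by have [] := std_parabolicP (rc_ucent RC eL).
Qed.

Lemma lmin_reps_unit (I : {set R}) r : r \in lmin_reps S I -> r \in unit_group R.
Proof. by rewrite inE => /andP[]. Qed.

Lemma rmin_reps_unit (I : {set R}) r : r \in rmin_reps S I -> r \in unit_group R.
Proof. by rewrite inE => /andP[]. Qed.

Lemma left_standardP r x e y : left_standard L S r (val x) e (val y) <-> lstd r x e y.
Proof.
split=> -[rE eL hx hy].
  by split; [| | apply (lmin_lambda_down x eL) | apply (rmin_lambda y eL)].
by split; [| | apply (lmin_lambda_down x eL) | apply (rmin_lambda y eL)].
Qed.

Lemma gen_lambda_up e r : r \in gen (lambda_up S e) -> r \in unit_group R.
Proof. by apply: sub_gen_unit; apply/subsetP=> s; rewrite inE => /andP[]. Qed.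

Lemma gen_lambda_down e r : e \in L -> r \in gen (lambda_down S e) -> r \in unit_group R.
Proof. by move=> eL; apply: sub_gen_unit; have [] := std_parabolicP (rc_ustab RC eL). Qed.

Lemma adh_plusP r s : adh_plus L S r s <-> exists x e y a f b,
  [/\ lstd r x e y, lstd s a f b & plus_le x e y a f b].
Proof.
split.
  case=> x0 [e [y0 [a0 [f [b0 [h1 h2 ef [w0 [/imset2P[w1 w2 w1U w2D wE] le1 le2]]]]]]]].
  have [_ eL hx hy] := h1; have [_ fL ha hb] := h2.
  have [x xE] := unit_groupW (lmin_reps_unit hx); have [a aE] := unit_groupW (lmin_reps_unit ha).
  have [y yE] := unit_groupW (rmin_reps_unit hy); have [b bE] := unit_groupW (rmin_reps_unit hb).
  have [w1' w1E] := unit_groupW (gen_lambda_up w1U).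
  have [w2' w2E] := unit_groupW (gen_lambda_down eL w2D).
  exists x, e, y, a, f, b; split;
    [by apply/left_standardP; rewrite -xE -yE | by apply/left_standardP; rewrite -aE -bE |].
  split; first by []; exists w1', w2'; split.
  - by rewrite -lambda_up_gen -w1E.
  - by rewrite -lambda_down_gen // -w2E.
  - by move: le1; rewrite wE w1E w2E xE aE.
  - by move: le2; rewrite wE w1E w2E bE yE.
case=> x [e [y [a [f [b [h1 h2 [ef [w1 [w2 [w1U w2D le1 le2]]]]]]]]]].
have [_ eL hx hy] := h1; have [_ fL ha hb] := h2.
exists (val x), e, (val y), (val a), f, (val b); split;
  [exact/left_standardP | exact/left_standardP | by [] |].
exists (val (w1 * w2)); split; [|exact: le1 | exact: le2].
by apply/imset2P; exists (val w1) (val w2); rewrite ?lambda_up_gen ?lambda_down_gen.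
Qed.
End RennerCoxeter.

(** * Green's relations and standard forms *)

Section Green.

Variables (R : finMonoidType) (L S : {set R}).
Hypothesis RC : renner_coxeter L S.
Local Notation gT := (unit_type R).
Implicit Types (e f k r t : R) (a b c u v w x y z : gT).

(** [e * f] and [f * e] are both meets of the same pair, so each is below the other. *)
Lemma idem_comm e f : e \in idems R -> f \in idems R -> e * f = f * e.
Proof.
move=> eE fE; have [m1 _ _ m2] := rc_meet RC eE fE; have [m3 a1 a2 m4] := rc_meet RC fE eE.
have [m1' b1 b2 _] := rc_meet RC eE fE.
have /andP[/eqP <- _] := m4 _ m1' b2 b1.
by have /andP[_ /eqP ->] := m2 _ m3 a2 a1.
Qed.

Lemma idemP e : reflect (e * e = e) (e \in idems R).
Proof. by rewrite inE; apply: eqP. Qed.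

Lemma idem_conj u e : e \in idems R -> val u * e * val u^-1 \in idems R.
Proof.
by move=> /idemP ee; apply/idemP; rewrite !mulgA val_unitVKr -(mulgA _ e e) ee.
Qed.

Lemma unit_idem r : exists u, exists2 k, k \in idems R & r = val u * k.
Proof.
have [_ UE] := rc_factorizable RC.
have : r \in mulset (unit_group R) (idems R) by rewrite UE inE.
by case/imset2P=> _ k /unit_groupW[u ->] kE ->; exists u, k.
Qed.

Lemma idem_unit r : exists u, exists2 k, k \in idems R & r = k * val u.
Proof.
have [EU _] := rc_factorizable RC.
have : r \in mulset (idems R) (unit_group R) by rewrite EU inE.
by case/imset2P=> k _ kE /unit_groupW[u ->] ->; exists u, k.
Qed.

(** Write r and t as units times idempotents k and k'. Equality of the left ideals gives k k' = k
    and k' k = k', and idempotents commute, so k = k' and only units separate r from t. *)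
Lemma greenLP r t : greenL r t <-> exists u, t = val u * r.
Proof.
split=> [rt|[u ->]]; last first.
  apply/setP=> z; apply/imsetP/imsetP=> -[x _ ->].
    by exists (x * val u^-1); rewrite ?inE // -mulgA val_unitK.
  by exists (x * val u); rewrite ?inE // mulgA.
have [p [k kE rk]] := unit_idem r; have [q [k' k'E tk]] := unit_idem t.
have /imsetP[g _ rg] : r \in [set x * t | x : R].
  by rewrite -rt; apply/imsetP; exists 1; rewrite ?mul1g.
have /imsetP[h _ th] : t \in [set x * r | x : R].
  by rewrite rt; apply/imsetP; exists 1; rewrite ?mul1g.
have kk' : k * k' = k.
  have -> : k = val p^-1 * r by rewrite rk val_unitK.
  by rewrite rg tk -!mulgA (idemP _ k'E).
have k'k : k' * k = k'.
  have -> : k' = val q^-1 * t by rewrite tk val_unitK.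
  by rewrite th rk -!mulgA (idemP _ kE).
exists (q * p^-1); rewrite rk val_unitM -mulgA val_unitK tk.
by rewrite (etrans (esym k'k) (etrans (idem_comm k'E kE) kk')).
Qed.

Lemma greenRP r t : greenR r t <-> exists u, t = r * val u.
Proof.
split=> [rt|[u ->]]; last first.
  apply/setP=> z; apply/imsetP/imsetP=> -[x _ ->].
    by exists (val u^-1 * x); rewrite ?inE // -mulgA val_unitVK.
  by exists (val u * x); rewrite ?inE // mulgA.
have [p [k kE rk]] := idem_unit r; have [q [k' k'E tk]] := idem_unit t.
have /imsetP[g _ rg] : r \in [set t * x | x : R].
  by rewrite -rt; apply/imsetP; exists 1; rewrite ?mulg1.
have /imsetP[h _ th] : t \in [set r * x | x : R].
  by rewrite rt; apply/imsetP; exists 1; rewrite ?mulg1.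
have kk' : k' * k = k.
  have -> : k = r * val p^-1 by rewrite rk val_unitKr.
  by rewrite rg tk !mulgA (idemP _ k'E).
have k'k : k * k' = k'.
  have -> : k' = t * val q^-1 by rewrite tk val_unitKr.
  by rewrite th rk !mulgA (idemP _ kE).
exists (p^-1 * q); rewrite rk val_unitM mulgA val_unitKr tk.
by rewrite (etrans (esym k'k) (etrans (idem_comm kE k'E) kk')).
Qed.

(** f and v e v^-1 are idempotents differing by a unit on the right, so each absorbs the other from
    the left; since they commute, they are equal. *)
Lemma conj_of_bimul e f u v : e \in idems R -> f \in idems R ->
  val v * e * val u = f -> val v * e * val v^-1 = f.
Proof.
move=> eE fE vu; set k := _ * _ * _; have kE : k \in idems R by apply: idem_conj.
have fk : f = k * val (v * u) by rewrite -vu /k val_unitM mulgA val_unitVKr.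
have kf : k = f * val (v * u)^-1 by rewrite fk val_unitKr.
have kfk : f * k = k by rewrite {1}kf mulgA (idemP _ fE) -kf.
by rewrite -kfk idem_comm // {1}fk mulgA (idemP _ kE) -fk.
Qed.

Lemma L_idem e : e \in L -> e \in idems R.
Proof. exact: (subsetP (rc_lattice_sub RC)). Qed.

Lemma L_transversal e f u v : e \in L -> f \in L -> val v * e * val u = f -> e = f.
Proof.
move=> eL fL /(conj_of_bimul (L_idem eL) (L_idem fL)) vf.
have [g [_ gU]] := rc_transversal RC (L_idem eL).
rewrite -(gU f); last by split=> //; exists (val v); [apply: valP | rewrite -val_unitV].
apply/esym/gU; split=> //; exists 1; first exact: unit_group1.
by rewrite -[uinv 1]/(val (1 : gT)^-1) invg1 mulg1 mul1g.
Qed.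

Lemma ucentg_of_mul e u v : e \in idems R -> val v * e = e * val u -> v \in ucentg e.
Proof.
move=> eE vu; have h : val v * e * val u^-1 = e by rewrite vu val_unitKr.
by apply/ucentP; rewrite -{2}(conj_of_bimul eE eE h) val_unitVKr.
Qed.

Lemma L_form r : exists a e b, e \in L /\ r = val a * e * val b.
Proof.
have [u [k kE ->]] := unit_idem r.
have [e [[eL [w0 /unit_groupW[w ->] we]] _]] := rc_transversal RC kE.
rewrite -val_unitV in we; exists (u * w^-1), e, w; split=> //.
by rewrite -we val_unitM !mulgA !val_unitVKr.
Qed.

(** Finiteness makes J equal to D. If e = g f h and f = g' e h', counting ideals shows that g f is
    R-related to e and L-related to f; hence f = v e u with u and v units, and the transversal
    forces e = f. *)
Lemma greenJP r t : greenJ r t <-> exists u v, t = val u * r * val v.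
Proof.
split=> [rt|[u [v ->]]]; last first.
  apply/setP=> z; apply/imset2P/imset2P=> -[x y _ _ ->].
    exists (x * val u^-1) (val v^-1 * y); rewrite ?inE //.
    by rewrite -!mulgA val_unitVK val_unitK.
  by exists (x * val u) (val v * y); rewrite ?inE // !mulgA.
have [a [e [b [eL rE]]]] := L_form r; have [c [f [d [fL tE]]]] := L_form t.
have fromJ (r1 r2 : R) : greenJ r1 r2 -> exists g h, r1 = g * r2 * h.
  move=> E; have /imset2P[g h _ _ ->] : r1 \in [set x * r2 * y | x : R, y : R].
    by rewrite -E; apply/imset2P; exists 1 1; rewrite ?mul1g ?mulg1.
  by exists g, h.
have [g [h eE]] : exists g h, e = g * f * h.
  have [g [h]] := fromJ _ _ rt; rewrite rE tE => E.
  exists (val a^-1 * g * val c), (val d * h * val b^-1).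
  have -> : e = val a^-1 * (val a * e * val b) * val b^-1
    by rewrite !mulgA val_unitKr -mulgA val_unitK.
  by rewrite E !mulgA.
have [g' [h' fE]] : exists g h, f = g * e * h.
  have [g' [h']] := fromJ _ _ (esym rt); rewrite rE tE => E.
  exists (val c^-1 * g' * val a), (val b * h' * val d^-1).
  have -> : f = val c^-1 * (val c * f * val d) * val d^-1
    by rewrite !mulgA val_unitKr -mulgA val_unitK.
  by rewrite E !mulgA.
pose Ri (r : R) := [set r * x | x : R]; pose Le (r : R) := [set x * r | x : R].
have sub_mulR (x y z : R) : Ri (x * y * z) \subset Ri (x * y).
  by apply/subsetP=> _ /imsetP[w _ ->]; apply/imsetP; exists (z * w); rewrite ?mulgA.
have sub_mulL (x y : R) : Le (x * y) \subset Le y.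
  by apply/subsetP=> _ /imsetP[w _ ->]; apply/imsetP; exists (w * x); rewrite ?mulgA.
have cardR (x y : R) : (#|Ri (x * y)%g| <= #|Ri y|)%N.
  suff /subset_leq_card lt : Ri (x * y) \subset [set x * z | z in Ri y].
    exact: leq_trans lt (leq_imset_card _ _).
  apply/subsetP=> _ /imsetP[w _ ->]; apply/imsetP; exists (y * w); rewrite ?mulgA //.
  by apply/imsetP; exists w.
have cardL (x y : R) : (#|Le (x * y)%g| <= #|Le x|)%N.
  suff /subset_leq_card lt : Le (x * y) \subset [set z * y | z in Le x].
    exact: leq_trans lt (leq_imset_card _ _).
  apply/subsetP=> _ /imsetP[w _ ->]; apply/imsetP; exists (w * x); rewrite ?mulgA //.
  by apply/imsetP; exists w.
have leR (x y z : R) : (#|Ri (x * y * z)%g| <= #|Ri y|)%N.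
  exact: leq_trans (subset_leq_card (sub_mulR _ _ _)) (cardR _ _).
have leL (x y z : R) : (#|Le (x * y * z)%g| <= #|Le y|)%N.
  exact: leq_trans (cardL _ _) (subset_leq_card (sub_mulL _ _)).
(* e R lies in g f R, which has at most as many elements as f R, and f R at most as many as e R: all
   inclusions are equalities. *)
have [u gfE] : exists u, g * f = e * val u.
  apply/greenRP/eqP; rewrite eqEcard {1}eE sub_mulR /=.
  by apply: leq_trans (cardR _ _) _; rewrite [X in Ri X]fE leR.
have [v fE'] : exists v, f = val v * (g * f).
  apply/greenLP/eqP; rewrite eqEcard sub_mulL gfE /= {1}fE.
  by apply: leq_trans (leL _ _ _) _; rewrite -{1}(val_unitKr u e) cardL.
have ef : e = f by apply: (@L_transversal e f u v) => //; rewrite -mulgA -gfE.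
exists (c * a^-1), (b^-1 * d); rewrite tE rE -ef !val_unitM.
by rewrite !mulgA val_unitVKr val_unitKr.
Qed.

(** The right factor is normalised first: what is removed from b commutes with e and passes to a.
    The later correction of the left factor lies in [ustabg e] and is swallowed by e. *)
Lemma lstd_form e a b : e \in L -> exists c d, [/\ c \in ucentg e, d \in ucentg e &
  lstd L S (val a * e * val b) (a * c) e (d * b)].
Proof.
move=> eL; have [d dC dmin] := rminimal_ex RC b (ucent_parabolic RC eL).
have [c cD cmin] := lminimal_ex RC (a * d^-1) (ustab_parabolic RC eL).
have [ce ec] := ustabP _ _ cD.
exists (d^-1 * c), d; split=> //.
  by rewrite groupM ?groupV //; apply/ucentP; rewrite ce ec.
rewrite mulgA; split=> //; rewrite !val_unitM -(mulgA _ (val c)) ce.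
by rewrite [RHS]mulgA -(mulgA _ e (val d)) -(ucentP _ _ dC) !mulgA val_unitVKr.
Qed.

Lemma lstd_greenJ r x e y t : lstd L S r x e y -> greenJ r t -> exists x' y', lstd L S t x' e y'.
Proof.
case=> -> eL _ _ /greenJP[u [v ->]]; have [c [d [_ _ h]]] := lstd_form (u * x) (y * v) eL.
by exists (u * x * c), (d * (y * v)); rewrite !val_unitM !mulgA in h *.
Qed.

Lemma lstd_greenL r x e y t : lstd L S r x e y -> greenL r t -> exists x', lstd L S t x' e y.
Proof.
case=> -> eL _ ymin /greenLP[u ->];
  have [d dD dmin] := lminimal_ex RC (u * x) (ustab_parabolic RC eL).
exists (u * x * d); split=> //.
by have [de _] := ustabP _ _ dD; rewrite !val_unitM -(mulgA _ (val d)) de !mulgA.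
Qed.

Lemma lstd_greenR r x e y t : lstd L S r x e y -> greenR r t ->
  exists x' y', lstd L S t x' e y' /\ exists2 v, v \in ucentg e & x' = x * v.
Proof.
case=> -> eL _ _ /greenRP[u ->]; have [c [d [cC _ h]]] := lstd_form x (y * u) eL.
exists (x * c), (d * (y * u)); split; last by exists c.
by rewrite !val_unitM !mulgA in h *.
Qed.

(** The L-relation keeps y. The R-relation then gives x' e y = x e y u, so x^-1 x' e is e times a
    unit, and [ucentg_of_mul] puts x^-1 x' in [ucentg e]. *)
Lemma lstd_greenH r x e y t : lstd L S r x e y -> greenH r t ->
  exists x', lstd L S t x' e y /\ exists2 v, v \in ucentg e & x' = x * v.
Proof.
move=> h [rL rR]; have [rE eL xmin ymin] := h.
have [x' h'] := lstd_greenL h rL; exists x'; split=> //.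
exists (x^-1 * x'); last by rewrite mulKVg.
have [u tE] := (greenRP _ _).1 rR; have [tE' _ _ _] := h'.
apply: (@ucentg_of_mul e (y * u * y^-1)); first exact: L_idem.
rewrite !val_unitM -mulgA -(val_unitKr y (val x' * e)) -tE' tE rE !mulgA.
by rewrite -!mulgA val_unitK.
Qed.
End Green.

(** * Extremal elements for the order + *)

Lemma in_class_sym (R : finMonoidType) T (r t : R) : in_class T r t -> in_class T t r.
Proof. by case: T; rewrite /in_class /greenH /greenJ /greenL /greenR;
  [move-> | move-> | move-> | case=> -> ->]. Qed.

Lemma in_class_trans (R : finMonoidType) T (s r t : R) :
  in_class T r s -> in_class T s t -> in_class T r t.
Proof.
by case: T; rewrite /in_class /greenH /greenJ /greenL /greenR;
  [move-> | move-> | move-> | case=> -> ->].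
Qed.

Section AdherencePlus.

Variables (R : finMonoidType) (L S : {set R}).
Hypothesis RC : renner_coxeter L S.
Local Notation gT := (unit_type R).
Local Notation le := (@ubruhat R S).
Local Notation D := (@ustabg R).
Local Notation C := (@ucentg R).
Local Notation U := (@upg R S).
Local Notation lmin := (@lminimal R S).
Local Notation rmin := (@rminimal R S).
Implicit Types (e f r s t : R) (a b u v w x y z : gT).

Let CP e : e \in L -> parabolic S (C e) := @ucent_parabolic R L S RC e.
Let DP e : e \in L -> parabolic S (D e) := @ustab_parabolic R L S RC e.

Lemma ustab_sub_ucent e : D e \subset C e.
Proof. exact: normal_sub (ustab_normal e). Qed.

Lemma lminimal_sub (H K : {set gT}) x : H \subset K -> lmin K x -> lmin H x.
Proof. by move=> /subsetP HK xK v /HK; apply: xK. Qed.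

Lemma lminimal1 (H : {set gT}) : lmin H 1.
Proof. by move=> v _; apply: ubruhat_ge1 RC _. Qed.

Lemma rminimal1 (H : {set gT}) : rmin H 1.
Proof. by move=> v _; apply: ubruhat_ge1 RC _. Qed.

(** Take the minimal representative of the coset of the longest element: by lifting, a minimal u
    below w0 is below every element of that coset. *)
Lemma lminimal_top e : e \in L -> exists x, lmin (D e) x /\ forall u, lmin (D e) u -> le u x.
Proof.
move=> eL; have [w0 w0P] := ubruhat_top RC; have [d dD xmin] := lminimal_ex RC w0 (DP eL).
by exists (w0 * d); split=> // u umin; apply: lminimal_le RC _ _ _ _ (DP eL) umin _ dD.
Qed.

Lemma rminimal_top e : e \in L -> exists y, rmin (C e) y /\ forall u, rmin (C e) u -> le u y.
Proof.
move=> eL; have [w0 w0P] := ubruhat_top RC; have [c cC ymin] := rminimal_ex RC w0 (CP eL).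
by exists (c * w0); split=> // u umin; apply: rminimal_le RC _ _ _ _ (CP eL) umin _ cC.
Qed.

(** The top of the coset x W_(lambda e) need not be [D e]-minimal, so it is lowered inside its
    [D e]-coset; minimal elements below the top remain below. The two-stage clause (u0 below the
    coset, then u below a translate of u0) is the form in which [top_plus_le] meets it. *)
Lemma ucent_coset_top e x : e \in L -> exists c, [/\ c \in C e, lmin (D e) (x * c)
  & forall u u0 v v', lmin (D e) u -> v \in C e -> v' \in C e ->
      le u0 (x * v) -> le u (u0 * v') -> le u (x * c)].
Proof.
move=> eL; have [c cC cmax] := coset_max_ex RC x (CP eL).
have [d dD dmin] := lminimal_ex RC (x * c) (DP eL).
have dC := subsetP (ustab_sub_ucent e) d dD.
exists (c * d); rewrite groupM // mulgA; split=> // u u0 v v' umin vC v'C u0v uv'.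
apply: lminimal_le RC _ _ _ _ (DP eL) umin _ dD.
apply: ubruhat_trans uv' _; apply: (cmax) v'C; apply: ubruhat_trans u0v _.
by rewrite -(mulKVg c v) mulgA; apply: cmax; [apply: ubruhat_refl | rewrite groupM ?groupV].
Qed.

(** A witness taken in [D e] alone costs nothing on the left, by minimality of x; the two conditions
    become independent. *)
Lemma plus_le_intro x e y a f b d : e \in L -> idem_le e f -> lmin (D e) x -> le x a ->
  d \in D e -> le (d * b) y -> plus_le S x e y a f b.
Proof.
move=> eL ef xmin xa dD db; split=> //; exists 1, d^-1; rewrite mul1g invgK.
split; [exact: group1 | by rewrite groupV | | exact: db].
by apply: lminimal_le RC _ _ _ _ (DP eL) xmin xa _; rewrite groupV.
Qed.

Lemma plus_le_stab x e y a f b : e \in L -> f \in L -> rmin (C f) b ->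
  plus_le S x e y a f b -> exists2 d, d \in D e & le (d * b) y.
Proof.
move=> eL fL bmin [ef [w1 [w2 [w1U w2D _ wy]]]].
have [d dD dmin] := rminimal_ex RC b (DP eL); exists d => //.
apply: ubruhat_trans wy; rewrite invMg -mulgA.
apply: rminimal_le RC _ _ _ _ (DP eL) (dmin) _ _; rewrite ?groupV //.
apply: (@ubruhat_trans _ _ b); first by have := dmin d^-1; rewrite mulKg; apply; rewrite groupV.
by apply: bmin; rewrite groupV (subsetP (up_sub_ucent S f)).
Qed.

(** For J and L the left factor is free, and X is the largest minimal representative; for R and H it
    is confined to x W_(lambda e), and the last clause records the absorption of
    [ucent_coset_top]. *)
Definition top_left T e x X := lmin (D e) X /\
  match T with
  | GreenJ | GreenL => forall u, lmin (D e) u -> le u X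
  | GreenR | GreenH => exists2 c, c \in C e & X = x * c /\
      forall u u0 v v', lmin (D e) u -> v \in C e -> v' \in C e ->
        le u0 (x * v) -> le u (u0 * v') -> le u X
  end.

Definition top_right T y : gT := match T with GreenJ | GreenR => 1 | GreenL | GreenH => y end.

Lemma top_left_ex T e x : e \in L -> exists X, top_left T e x X.
Proof.
move=> eL; have [X [Xmin XP]] := lminimal_top eL.
have [c [cC cmin cP]] := ucent_coset_top x eL.
by case: T; [exists X | exists X | exists (x * c) | exists (x * c)];
  split=> //; exists c.
Qed.

Lemma top_is_max T r x e y X : lstd L S r x e y -> top_left T e x X ->
  let m := val X * e * val (top_right T y) in
  lstd L S m X e (top_right T y) /\ is_max_class L S AdhPlus T r m.
Proof.
move=> h [Xmin XP] m; have [rE eL xmin ymin] := h.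
have ym : rmin (C e) (top_right T y) by case: (T) => //; apply: rminimal1.
have hm : lstd L S m X e (top_right T y) by split.
split=> //; split.
  have xXJ : greenJ r m.
    apply/(greenJP RC); exists (X * x^-1), (y^-1 * top_right T y).
    by rewrite rE !val_unitM !mulgA val_unitVKr val_unitKr.
  have eC c : c \in C e -> val c * e = e * val c by move/ucentP.
  rewrite /m /top_right /in_class in xXJ *;
    case: (T) XP xXJ => [_ //|_ _|[c cC [-> _]] _|[c cC [-> _]] _].
  - by apply/(greenLP RC); exists (X * x^-1); rewrite rE val_unitM !mulgA val_unitVKr.
  - apply/(greenRP RC); exists (y^-1 * c).
    by rewrite rE !val_unitM mulg1 mulgA val_unitKr -!mulgA eC.
  split; first by apply/(greenLP RC); exists (x * c * x^-1);
    rewrite rE !val_unitM !mulgA val_unitVKr.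
  apply/(greenRP RC); exists (y^-1 * c * y).
  by rewrite rE !val_unitM !mulgA val_unitKr -(mulgA _ (val c)) eC // !mulgA.
have ee : idem_le e e by rewrite /idem_le /= (idem_in_L RC) // eqxx.
have main t x' y' : lstd L S t x' e y' -> le x' X -> le (top_right T y) y' -> adh_plus L S t m.
  move=> ht xX yY; apply/(adh_plusP RC); exists x', e, y', X, e, (top_right T y); split=> //.
  have [_ _ x'min _] := ht.
  by apply: plus_le_intro (group1 _) _; rewrite ?mul1g.
move=> t; rewrite /in_class; case: (T) XP main => XP main.
- case/(lstd_greenJ RC h)=> x' [y' ht]; have [_ _ x'min _] := ht.
  by apply: main ht _ _; [apply: XP | apply: ubruhat_ge1 RC _].
- case/(lstd_greenL RC h)=> x' ht; have [_ _ x'min _] := ht.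
  by apply: main ht _ _; [apply: XP | apply: ubruhat_refl].
- case/(lstd_greenR RC h)=> x' [y' [ht [v vC x'E]]]; have [_ _ x'min _] := ht.
  apply: main ht _ _; last by apply: ubruhat_ge1 RC _.
  case: XP => c cC [_ hull]; apply: (hull x' x' v 1) => //; rewrite ?group1 ?mulg1 -?x'E //.
    exact: ubruhat_refl.
  exact: ubruhat_refl.
- case/(lstd_greenH RC h)=> x' [ht [v vC x'E]]; have [_ _ x'min _] := ht.
  apply: main ht _ _; last by apply: ubruhat_refl.
  case: XP => c cC [_ hull]; apply: (hull x' x' v 1) => //; rewrite ?group1 ?mulg1 -?x'E //.
    exact: ubruhat_refl.
  exact: ubruhat_refl.
Qed.

(** It suffices to prove X <= A and to find d in [D e] for the right factors, by [plus_le_intro].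
    This also works for H, since the right factor never needs to change. *)
Lemma top_plus_le T r s x e y a f b X A : lstd L S r x e y -> lstd L S s a f b ->
  top_left T e x X -> top_left T f a A -> plus_le S x e y a f b ->
  plus_le S X e (top_right T y) A f (top_right T b).
Proof.
move=> [_ eL xmin ymin] [_ fL amin bmin] [Xmin XP] [Amin AP] h.
have [d dD db] := plus_le_stab eL fL bmin h; have [ef [w1 [w2 [w1U w2D xw _]]]] := h.
have XD : lmin (D f) X by apply: lminimal_sub Xmin; apply: ustabS.
have XA : le X A.
  have coset : (exists2 c, c \in C e & X = x * c) ->
    (exists2 c, c \in C f & A = a * c /\
      forall u u0 v v', lmin (D f) u -> v \in C f -> v' \in C f ->
        le u0 (a * v) -> le u (u0 * v') -> le u A) -> le X A.
    (* Split c = v w: X is below x v by its own minimality, x is below a w1 by that of x, and v lies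
       in [U e], hence in [U f]. The absorbing coset of a takes in both w1 and v. *)
    case=> c cC XE [c' c'C [_ AP']]; have [v vU [w wD cE]] := ucent_decomp RC eL cC.
    apply: (AP' X x w1 v) => //; try exact: (subsetP (up_sub_ucent S f)).
    - by apply: (subsetP (up_sub_ucent S f)); apply: (subsetP (upS RC eL fL ef)).
    - have := lminimal_le RC (DP eL) xmin xw (_ : w2^-1 \in D e).
      by rewrite mulgA mulgK; apply; rewrite groupV.
    have := Xmin w^-1; rewrite {2}XE cE mulgA mulgK; apply; by rewrite groupV.
  by case: (T) XP AP => [_ AP|_ AP|[c cC [XE _]]|[c cC [XE _]]]; try (by apply: AP);
    apply: coset; exists c.
have [d' d'D d'b] : exists2 d, d \in D e & le (d * top_right T b) (top_right T y).
  rewrite /top_right; case: (T); try (by exists d); exists 1; rewrite ?mulg1 ?group1 //;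
    exact: ubruhat_refl.
exact: plus_le_intro d'D d'b.
Qed.

(** H is excluded because there y is fixed while x still moves in its coset, so the witness cannot
    be chosen anew as in [bot_plus_le]. The rook monoid shows that H-minima can exist and yet fail
    to compare. *)
Definition bot_form T e x y X Y := rmin (C e) Y /\
  match T with
  | GreenJ => X = 1 /\ forall u, rmin (C e) u -> le u Y
  | GreenL => X = 1 /\ Y = y
  | GreenR => [/\ lmin (C e) X, exists2 c, c \in C e & X = x * c
                & forall u, rmin (C e) u -> le u Y]
  | GreenH => False
  end.

Lemma bot_form_ex T e x y : e \in L -> rmin (C e) y -> T <> GreenH ->
  exists X Y, bot_form T e x y X Y.
Proof.
move=> eL ymin; have [Y [Ymin YP]] := rminimal_top eL.
have [c cC cmin] := lminimal_ex RC x (CP eL).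
case: T => // _; [exists 1, Y | exists 1, y | exists (x * c), Y] => //.
by split=> //; split=> //; exists c.
Qed.

Lemma bot_form_lmin T e x y X Y : bot_form T e x y X Y -> lmin (C e) X.
Proof. by case=> _; case: T => // [] [] // -> _; apply: lminimal1. Qed.

Lemma bot_is_min T r x e y X Y : lstd L S r x e y -> bot_form T e x y X Y ->
  let m := val X * e * val Y in
  lstd L S m X e Y /\ is_min_class L S AdhPlus T r m.
Proof.
move=> h bot m; have XC := bot_form_lmin bot; have [rE eL xmin ymin] := h.
case: bot => Ymin bot; have XD : lmin (D e) X := lminimal_sub (ustab_sub_ucent e) XC.
have hm : lstd L S m X e Y by split.
split=> //; split.
  rewrite /m /in_class; case: (T) bot => // [_|[_ ->]|[_ [c cC ->] _]].
  - apply/(greenJP RC); exists (X * x^-1), (y^-1 * Y).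
    by rewrite rE !val_unitM !mulgA val_unitVKr val_unitKr.
  - by apply/(greenLP RC); exists (X * x^-1); rewrite rE val_unitM !mulgA val_unitVKr.
  - apply/(greenRP RC); exists (y^-1 * c * Y).
    by rewrite rE !val_unitM !mulgA val_unitKr -(mulgA _ (val c)) (ucentP _ _ cC) !mulgA.
have ee : idem_le e e by rewrite /idem_le /= (idem_in_L RC) // eqxx.
have main t x' y' : lstd L S t x' e y' -> le X x' -> le y' Y -> adh_plus L S m t.
  move=> ht xX yY; apply/(adh_plusP RC); exists X, e, Y, x', e, y'; split=> //.
  by apply: plus_le_intro (group1 _) _; rewrite ?mul1g.
move=> t; rewrite /in_class; case: (T) bot => // [[X1 YP]|[X1 Y1]|[_ [c cC XE] YP]].
- case/(lstd_greenJ RC h)=> x' [y' ht]; have [_ _ _ y'min] := ht.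
  by apply: main ht _ _; [rewrite X1; apply: ubruhat_ge1 RC _ | apply: YP].
- case/(lstd_greenL RC h)=> x' ht.
  by apply: main ht _ _; [rewrite X1; apply: ubruhat_ge1 RC _ | rewrite Y1; apply: ubruhat_refl].
- case/(lstd_greenR RC h)=> x' [y' [ht [v vC x'E]]]; have [_ _ _ y'min] := ht.
  apply: main ht _ _; last by apply: YP.
  have := XC (c^-1 * v); rewrite {2}XE mulgA mulgK -x'E; apply.
  by rewrite groupM ?groupV.
Qed.

(** For L both left factors are 1 and the old witness still serves; for J and R the freedom of Y
    allows a new witness. *)
Lemma bot_plus_le T r s x e y a f b X Y A B : lstd L S r x e y -> lstd L S s a f b ->
  bot_form T e x y X Y -> bot_form T f a b A B -> plus_le S x e y a f b ->
  plus_le S X e Y A f B.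
Proof.
move=> [_ eL xmin ymin] [_ fL amin bmin] botX botA [ef [w1 [w2 [w1U w2D xw wy]]]].
have XC := bot_form_lmin botX.
(* The witness is v z^-1, with z in [C e] making z v^-1 B minimal and therefore below the top Y. On
   the left z^-1 is harmless since X is [C e]-minimal, and its decomposition gives the witness the
   required shape. *)
have main v : v \in U f -> le X (A * v) -> (forall u, rmin (C e) u -> le u Y) ->
    plus_le S X e Y A f B.
  move=> vU Xv YP; split=> //; have [z zC zmin] := rminimal_ex RC (v^-1 * B) (CP eL).
  have [w1' w1'U [w2' w2'D zE]] : exists2 v, v \in U e & exists2 w, w \in D e & z^-1 = v * w.
    by apply: (ucent_decomp RC eL); rewrite groupV.
  exists (v * w1'), w2'; rewrite -(mulgA v) -zE; split=> //.
  - by rewrite groupM // (subsetP (upS RC eL fL ef)).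
  - by rewrite mulgA; apply: lminimal_le RC _ _ _ _ (CP eL) XC Xv _; rewrite groupV.
  by rewrite invMg invgK -mulgA; apply: YP.
case: botX botA => Ymin botX [Bmin botA].
case: (T) botX botA => // [[X1 YP] [A1 _]|[X1 ->] [A1 ->]|[_ [c cC XE] YP] [_ [c' c'C AE] _]].
- by apply: main (group1 _) _ YP; rewrite X1; apply: ubruhat_ge1 RC _.
- by split=> //; exists w1, w2; split=> //; rewrite X1; apply: ubruhat_ge1 RC _.
(* Passing from a to A = a c' turns w1 into c'^-1 w1, which may leave [U f]; its [D f] part d lies
   in [C e] and is discarded by minimality of X. *)
have c'wC : c'^-1 * w1 \in C f by rewrite groupM ?groupV // (subsetP (up_sub_ucent S f)).
have [v vU [d dD cE]] := ucent_decomp RC fL c'wC.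
apply: (main v) => //.
have Xx : le X x by have := XC c^-1; rewrite {2}XE mulgK; apply; rewrite groupV.
have Xaw : le X (a * w1).
  have := lminimal_le RC (CP eL) XC (ubruhat_trans Xx xw) (_ : w2^-1 \in C e).
  by rewrite mulgA mulgK; apply; rewrite groupV (subsetP (ustab_sub_ucent e)).
have := lminimal_le RC (CP eL) XC Xaw (_ : d^-1 \in C e).
have -> : a * w1 * d^-1 = A * v by rewrite AE -(mulgK d v) -cE !mulgA mulgK.
by apply; rewrite groupV (subsetP (ustab_sub_ucent e)) // (subsetP (ustabS ef)).
Qed.

Lemma is_max_class_eq eps T r r' m :
  in_class T r r' -> is_max_class L S eps T r' m -> is_max_class L S eps T r m.
Proof.
move=> rr' [r'm max]; split; first exact: in_class_trans rr' r'm.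
by move=> t rt; apply: max; apply: in_class_trans (in_class_sym rr') rt.
Qed.

Lemma is_min_class_eq eps T r r' m :
  in_class T r r' -> is_min_class L S eps T r' m -> is_min_class L S eps T r m.
Proof.
move=> rr' [r'm min]; split; first exact: in_class_trans rr' r'm.
by move=> t rt; apply: min; apply: in_class_trans (in_class_sym rr') rt.
Qed.

Lemma max_some eps T r s : max_class_le L S eps T r s -> some_class_le L S eps T r s.
Proof. by case=> m [n [[rm _] [sn _] mn]]; exists m, n. Qed.

Lemma min_some eps T r s : min_class_le L S eps T r s -> some_class_le L S eps T r s.
Proof. by case=> m [n [[rm _] [sn _] mn]]; exists m, n. Qed.

Lemma some_max_plus T r s :
  some_class_le L S AdhPlus T r s -> max_class_le L S AdhPlus T r s.
Proof.
case=> r' [s' [rr' ss' /(adh_plusP RC)[x [e [y [a [f [b [hr hs h]]]]]]]]].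
have [_ eL _ _] := hr; have [_ fL _ _] := hs.
have [X XP] := top_left_ex T x eL; have [A AP] := top_left_ex T a fL.
have [hm mmax] := top_is_max hr XP; have [hn nmax] := top_is_max hs AP.
exists (val X * e * val (top_right T y)), (val A * f * val (top_right T b)); split.
- exact: is_max_class_eq rr' mmax.
- exact: is_max_class_eq ss' nmax.
apply/(adh_plusP RC); do 6!eexists; split; [exact: hm | exact: hn |].
exact: top_plus_le hr hs XP AP h.
Qed.

Lemma some_min_plus T r s : T <> GreenH ->
  some_class_le L S AdhPlus T r s -> min_class_le L S AdhPlus T r s.
Proof.
move=> TH [r' [s' [rr' ss' /(adh_plusP RC)[x [e [y [a [f [b [hr hs h]]]]]]]]]].
have [_ eL _ ymin] := hr; have [_ fL _ bmin] := hs.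
have [X [Y XP]] := bot_form_ex x eL ymin TH; have [A [B AP]] := bot_form_ex a fL bmin TH.
have [hm mmin] := bot_is_min hr XP; have [hn nmin] := bot_is_min hs AP.
exists (val X * e * val Y), (val A * f * val B); split.
- exact: is_min_class_eq rr' mmin.
- exact: is_min_class_eq ss' nmin.
apply/(adh_plusP RC); do 6!eexists; split; [exact: hm | exact: hn |].
exact: bot_plus_le hr hs XP AP h.
Qed.
End AdherencePlus.

(** * From + to - by the involution *)

(** The inverse in the sense of inverse monoids. In a Renner-Coxeter system one exists, v^-1 k u^-1
    for r = u k v, and is unique by [starE], so the default is never reached. *)
Definition star (R : finMonoidType) (r : R) : R :=
  odflt r [pick t | (r * t * r == r) && (t * r * t == t)].

Definition green_dual T :=
  match T with GreenJ => GreenJ | GreenL => GreenR | GreenR => GreenL | GreenH => GreenH end.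

Section AdherenceMinus.

Variables (R : finMonoidType) (L S : {set R}).
Hypothesis RC : renner_coxeter L S.
Local Notation gT := (unit_type R).
Local Notation le := (@ubruhat R S).
Local Notation D := (@ustabg R).
Local Notation C := (@ucentg R).
Local Notation U := (@upg R S).
Local Notation lmin := (@lminimal R S).
Local Notation rmin := (@rminimal R S).
Implicit Types (e f k r s t : R) (a b u v w x y z : gT).

(** Uniqueness of inverses: once the idempotents r t, r t' and t r, t' r are commuted, t and t' both
    reduce to t' r t. *)
Lemma starE r t : r * t * r = r -> t * r * t = t -> star r = t.
Proof.
move=> rtr trt; rewrite /star; case: pickP => [t' /andP[/eqP rt'r /eqP t'rt'] /=|/(_ t)].
  have idem (p q : R) : p * q * p = p -> p * q \in idems R by move=> pq; apply/idemP;
    rewrite mulgA pq.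
  have t'E : t' = t' * (r * t * (r * t')) by rewrite -{1}t'rt' -{1}rtr !mulgA.
  have tE : t = t * r * (t' * r) * t by rewrite -{1}trt -{1}rt'r !mulgA.
  apply: etrans t'E (etrans _ (esym tE)).
  rewrite (idem_comm RC (idem _ _ rtr) (idem _ _ rt'r)) (idem_comm RC (idem _ _ trt) (idem _
    _ t'rt')).
  by rewrite !mulgA t'rt' -!mulgA (mulgA t r t) trt.
by rewrite rtr trt !eqxx.
Qed.

Lemma star_form u k v : k \in idems R ->
  star (val u * k * val v) = val v^-1 * k * val u^-1.
Proof.
move=> /idemP kk; apply: starE.
  by rewrite !mulgA val_unitKr -(mulgA _ k k) kk val_unitVKr -(mulgA _ k k) kk.
by rewrite !mulgA val_unitVKr -(mulgA _ k k) kk val_unitKr -(mulgA _ k k) kk.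
Qed.

Lemma starK : involutive (@star R).
Proof.
move=> r; have [u [k kE ->]] := unit_idem RC r.
by rewrite -[val u * k]mulg1 -(val_unit1 R) !star_form // !invgK.
Qed.

Lemma star_unit u v r : star (val u * r * val v) = val v^-1 * star r * val u^-1.
Proof.
have [p [k kE ->]] := unit_idem RC r; rewrite mulgA -val_unitM star_form //.
by rewrite -[X in star X]mulg1 -val_unit1 star_form // invg1 mul1g invMg val_unitM !mulgA.
Qed.

Lemma in_class_star T r t : in_class T r t -> in_class (green_dual T) (star r) (star t).
Proof.
have LR (p q : R) : greenL p q -> greenR (star p) (star q).
  case/(greenLP RC)=> u ->; apply/(greenRP RC); exists u^-1.
  by rewrite -[X in star X]mulg1 -val_unit1 star_unit invg1 mul1g.
have RL (p q : R) : greenR p q -> greenL (star p) (star q).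
  case/(greenRP RC)=> u ->; apply/(greenLP RC); exists u^-1.
  by rewrite -[X in star (X * _)]mul1g -val_unit1 star_unit invg1 mulg1.
case: T => [|||[rL rR]]; [|exact: LR|exact: RL|by split; [apply: RL|apply: LR]].
case/(greenJP RC)=> u [v ->]; apply/(greenJP RC); exists v^-1, u^-1.
by rewrite star_unit.
Qed.

Lemma lminimalV (H : {group gT}) x : lmin H x -> rmin H x^-1.
Proof.
by move=> h v vH; rewrite -[v]invgK -invMg; apply: ubruhat_inv RC _ _ _; apply: h; rewrite groupV.
Qed.

Lemma rminimalV (H : {group gT}) y : rmin H y -> lmin H y^-1.
Proof.
by move=> h v vH; rewrite -[v]invgK -invMg; apply: ubruhat_inv RC _ _ _; apply: h; rewrite groupV.
Qed.

Lemma right_standardP r x e y : right_standard L S r (val y) e (val x) <->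
  left_standard L S (star r) (val x^-1) e (val y^-1).
Proof.
split=> -[rE eL h1 h2]; split=> //.
- by rewrite rE star_form ?(L_idem RC).
- apply/(lmin_lambda_down RC x^-1 eL); apply: (@rminimalV (ustab_group e)).
  exact/(rmin_lambda_down RC x eL).
- apply/(rmin_lambda RC y^-1 eL); apply: (@lminimalV (ucent_group e)).
  exact/(lmin_lambda RC y eL).
- by rewrite -[r]starK rE star_form ?(L_idem RC) // !invgK.
- apply/(lmin_lambda RC y eL); rewrite -[y]invgK; apply: (@rminimalV (ucent_group e)).
  exact/(rmin_lambda RC y^-1 eL).
apply/(rmin_lambda_down RC x eL); rewrite -[x]invgK; apply: (@lminimalV (ustab_group e)).
exact/(lmin_lambda_down RC x^-1 eL).
Qed.

(** Inversion preserves the Bruhat order and reverses products, so it exchanges the two sides of a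
    standard form and also the two factors of the witness. *)
Lemma adh_minus_star r s : adh_minus L S r s <-> adh_plus L S (star r) (star s).
Proof.
split.
  case=> y0 [e [x0 [b0 [f [a0 [h1 h2 ef [w0 [/imset2P[w2 w1 w2D w1U wE] le1 le2]]]]]]]].
  have [_ eL hy hx] := h1; have [_ fL hb ha] := h2.
  have [x xE] := unit_groupW (rmin_reps_unit hx); have [a aE] := unit_groupW (rmin_reps_unit ha).
  have [y yE] := unit_groupW (lmin_reps_unit hy); have [b bE] := unit_groupW (lmin_reps_unit hb).
  have [w1' w1E] := unit_groupW (gen_lambda_up RC w1U).
  have [w2' w2E] := unit_groupW (gen_lambda_down RC eL w2D).
  rewrite xE yE in h1 le1 le2; rewrite aE bE in h2 le1 le2; rewrite w1E w2E in wE w1U w2D.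
  rewrite wE in le1 le2.
  exists (val x^-1), e, (val y^-1), (val a^-1), f, (val b^-1); split.
  - exact/right_standardP.
  - exact/right_standardP.
  - by [].
  exists (val (w2' * w1')^-1); split.
  - apply/imset2P; exists (val w1'^-1) (val w2'^-1); last by rewrite invMg val_unitM.
      by rewrite (lambda_up_gen RC) groupV -(lambda_up_gen RC).
    by rewrite (lambda_down_gen RC) // groupV -(lambda_down_gen RC).
  - have := @ubruhat_inv _ _ _ RC x (w2' * w1' * a) le1; by rewrite invMg.
  have := @ubruhat_inv _ _ _ RC (b * (w2' * w1')^-1) y le2; by rewrite invMg.
case=> x0 [e [y0 [a0 [f [b0 [h1 h2 ef [w0 [/imset2P[w1 w2 w1U w2D wE] le1 le2]]]]]]]].
have [_ eL hx hy] := h1; have [_ fL ha hb] := h2.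
have [x xE] := unit_groupW (lmin_reps_unit hx); have [a aE] := unit_groupW (lmin_reps_unit ha).
have [y yE] := unit_groupW (rmin_reps_unit hy); have [b bE] := unit_groupW (rmin_reps_unit hb).
have [w1' w1E] := unit_groupW (gen_lambda_up RC w1U).
have [w2' w2E] := unit_groupW (gen_lambda_down RC eL w2D).
rewrite xE yE in h1 le1 le2; rewrite aE bE in h2 le1 le2; rewrite w1E w2E in wE w1U w2D.
rewrite wE in le1 le2.
exists (val y^-1), e, (val x^-1), (val b^-1), f, (val a^-1); split.
- by apply/right_standardP; rewrite !invgK.
- by apply/right_standardP; rewrite !invgK.
- by [].
exists (val (w1' * w2')^-1); split.
- apply/imset2P; exists (val w2'^-1) (val w1'^-1); last by rewrite invMg val_unitM.
    by rewrite (lambda_down_gen RC) // groupV -(lambda_down_gen RC).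
  by rewrite (lambda_up_gen RC) groupV -(lambda_up_gen RC).
- have := @ubruhat_inv _ _ _ RC x (a * (w1' * w2')) le1; by rewrite invMg.
have := @ubruhat_inv _ _ _ RC ((w1' * w2')^-1 * b) y le2; by rewrite invMg.
Qed.

Lemma in_class_starV T r t : in_class (green_dual T) (star r) t -> in_class T r (star t).
Proof. by move/in_class_star; rewrite starK; case: T. Qed.

Lemma is_max_class_star T r m :
  is_max_class L S AdhPlus (green_dual T) (star r) m -> is_max_class L S AdhMinus T r (star m).
Proof.
case=> rm max; split; first exact: in_class_starV.
by move=> t /in_class_star rt; apply/adh_minus_star; rewrite starK; apply: max.
Qed.

Lemma is_min_class_star T r m :
  is_min_class L S AdhPlus (green_dual T) (star r) m -> is_min_class L S AdhMinus T r (star m).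
Proof.
case=> rm min; split; first exact: in_class_starV.
by move=> t /in_class_star rt; apply/adh_minus_star; rewrite starK; apply: min.
Qed.

Lemma some_class_le_star T r s : some_class_le L S AdhMinus T r s ->
  some_class_le L S AdhPlus (green_dual T) (star r) (star s).
Proof.
case=> a [b [ra sb ab]]; exists (star a), (star b); split; try exact: in_class_star.
exact/adh_minus_star.
Qed.

Lemma some_max eps T r s : some_class_le L S eps T r s -> max_class_le L S eps T r s.
Proof.
case: eps; first exact: some_max_plus.
case/some_class_le_star/(some_max_plus RC)=> m [n [hm hn mn]].
exists (star m), (star n); split; try exact: is_max_class_star.
by apply/adh_minus_star; rewrite !starK.
Qed.

Lemma some_min eps T r s : T <> GreenH ->
  some_class_le L S eps T r s -> min_class_le L S eps T r s.
Proof.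
move=> TH; case: eps; first exact: some_min_plus.
case/some_class_le_star/(some_min_plus RC); first by case: (T) TH.
move=> m [n [hm hn mn]]; exists (star m), (star n); split; try exact: is_min_class_star.
by apply/adh_minus_star; rewrite !starK.
Qed.
End AdherenceMinus.

(** * The rook monoid of rank 2 *)

(* [None] is the zero matrix, [Some (b, None)] the
   permutation matrix of the b-th power of the transposition and
   [Some (i, Some j)] the matrix unit E_ij. *)
Definition rook2 : Type := option (bool * option bool).

HB.instance Definition _ := Finite.on rook2.

Definition rook2_mul (x y : rook2) : rook2 :=
  match x, y with
  | Some (b, None), Some (c, None) => Some (b (+) c, None)
  | Some (b, None), Some (i, Some j) => Some (b (+) i, Some j)
  | Some (i, Some j), Some (b, None) => Some (i, Some (j (+) b))
  | Some (i, Some j), Some (k, Some l) => if j == k then Some (i, Some l) else None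
  | _, _ => None
  end.

Definition rook2_one : rook2 := Some (false, None).

Fact rook2_mulA : associative rook2_mul.
Proof. by move=> [[[] [[]|]]|] [[[] [[]|]]|] [[[] [[]|]]|]. Qed.

Fact rook2_mul1 : left_id rook2_one rook2_mul.
Proof. by move=> [[[] [[]|]]|]. Qed.

Fact rook2_mulr1 : right_id rook2_one rook2_mul.
Proof. by move=> [[[] [[]|]]|]. Qed.

HB.instance Definition _ := isMonoid.Build rook2 rook2_mulA rook2_mul1 rook2_mulr1.

Definition rook_perm (b : bool) : rook2 := Some (b, None).
Definition rook_unit (i j : bool) : rook2 := Some (i, Some j).
Definition rook_zero : rook2 := None.

Lemma rook2_unitE (x : rook2) :
  (x \in unit_group rook2) = if x is Some (_, None) then true else false.
Proof.
apply/idP/idP.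
  by case/unit_groupP=> -[[[] [[]|]]|]; move: x => [[[] [[]|]]|] [].
by move: x => [[b [c|]]|] // _; apply/unit_groupP; exists (Some (b, None)); case: b.
Qed.

Lemma rook2_unit_cases (x : rook2) : x \in unit_group rook2 -> exists b, x = rook_perm b.
Proof. by rewrite rook2_unitE; move: x => [[b [c|]]|] // _; exists b. Qed.

Lemma rook2_uinv b : uinv (rook_perm b) = rook_perm b.
Proof.
have : rook_perm b \in unit_group rook2 by rewrite rook2_unitE.
by move/uinvP=> []; case: (uinv _) => [[[] [d|]]|]; case: b.
Qed.

Lemma gen0 (R : finMonoidType) : gen set0 = [set 1 : R].
Proof.
apply/eqP; rewrite eqEsubset; apply/andP; split.
  apply: bigcap_inf; rewrite sub0set andbT; apply/is_subgroupP; split.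
  - by apply/subsetP=> x /set1P->; apply: unit_group1.
  - exact: set11.
  - by move=> x y /set1P-> /set1P->; rewrite mulg1 set11.
  - move=> x /set1P->; have [h _] := uinvP (unit_group1 R).
    by rewrite mul1g in h; rewrite h set11.
by apply/bigcapsP=> A /andP[/is_subgroupP[_ A1 _ _] _]; rewrite sub1set.
Qed.

Definition rook_S : {set rook2} := [set rook_perm true].
Definition rook_L : {set rook2} := [set x in [:: rook_perm false; rook_unit false false;
  rook_zero]].

Lemma rook_gen : gen rook_S = unit_group rook2.
Proof.
apply/eqP; rewrite eqEsubset; apply/andP; split.
  apply: bigcap_inf; apply/andP; split.
    apply/is_subgroupP; split=> //; first exact: unit_group1.
      by move=> x y; apply: unit_groupM.
    by move=> x; apply: uinv_unit.
  by rewrite sub1set rook2_unitE.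
apply/bigcapsP=> A /andP[/is_subgroupP[_ A1 _ _]]; rewrite sub1set => As.
by apply/subsetP=> x /rook2_unit_cases[[] ->].
Qed.

Lemma rook_coxeter : coxeter_system rook_S.
Proof.
split; [by rewrite sub1set rook2_unitE | exact: rook_gen |].
(* S is a singleton, so only the diagonal value of the Coxeter matrix matters. *)
exists (fun _ _ => 1%N); split.
- by split=> // s t /set1P-> /set1P->; rewrite eqxx.
- by move=> s t /set1P-> /set1P->.
move=> G h hS; have hh : h (rook_perm true) * h (rook_perm true) = 1.
  by have := hS _ _ (set11 _) (set11 _); rewrite expg1.
exists (fun x => if x == rook_perm true then h (rook_perm true) else 1).
  move=> x y /rook2_unit_cases[b ->] /rook2_unit_cases[c ->].
  by case: b; case: c; rewrite /= ?mul1g ?mulg1 ?hh.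
by move=> x /set1P->; rewrite eqxx.
Qed.

Lemma rook_LP (P : rook2 -> Prop) : P (rook_perm false) -> P (rook_unit false false) ->
  P rook_zero -> {in rook_L, forall e, P e}.
Proof. by move=> P1 Pe P0 e; rewrite !inE => /or3P[] /eqP->. Qed.

Lemma rook_renner_coxeter : renner_coxeter rook_L rook_S.
Proof.
have idemE (x : rook2) : (x \in idems rook2) =
    (x \in [:: rook_perm false; rook_unit false false; rook_unit true true; rook_zero]).
  by rewrite inE; move: x => [[[] [[]|]]|].
have unitE b : rook_perm b \in unit_group rook2 by rewrite rook2_unitE.
have ucentE (e : rook2) (I : {set rook2}) : I = set0 \/ I = rook_S ->
    (forall b, (rook_perm b * e == e * rook_perm b) = (rook_perm b \in gen I)) ->
      is_std_parabolic rook_S (ucent e).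
  move=> IE eI; exists I; first by case: IE => ->; rewrite ?sub0set.
  apply/setP=> x; rewrite [RHS]inE; have [xU|nx] := boolP (x \in unit_group rook2).
    by have [b ->] := rook2_unit_cases xU; rewrite eI.
  apply: contraNF nx; case: IE => ->; last by rewrite rook_gen.
  by rewrite gen0 => /set1P->; apply: unit_group1.
have ustabE (e : rook2) (I : {set rook2}) : I = set0 \/ I = rook_S ->
    (forall b, (rook_perm b * e == e) && (e * rook_perm b == e) = (rook_perm b \in gen I)) ->
      is_std_parabolic rook_S (ustab e).
  move=> IE eI; exists I; first by case: IE => ->; rewrite ?sub0set.
  apply/setP=> x; rewrite [RHS]inE; have [xU|nx] := boolP (x \in unit_group rook2).
    by have [b ->] := rook2_unit_cases xU; rewrite eI.
  apply: contraNF nx; case: IE => ->; last by rewrite rook_gen.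
  by rewrite gen0 => /set1P->; apply: unit_group1.
split.
- split; apply/setP=> x; rewrite [RHS]inE; apply/imset2P.
    case: x => [[i [j|]]|].
    + exists (rook_unit i i) (rook_perm (i (+) j)); rewrite ?idemE ?unitE //; by case: i; case: j.
    + by exists (rook_perm false) (rook_perm i); rewrite ?idemE ?unitE //; case: i.
    + by exists rook_zero (rook_perm false); rewrite ?idemE ?unitE.
  case: x => [[i [j|]]|].
  + exists (rook_perm (i (+) j)) (rook_unit j j); rewrite ?idemE ?unitE //; by case: i; case: j.
  + by exists (rook_perm i) (rook_perm false); rewrite ?idemE ?unitE //; case: i.
  + by exists (rook_perm false) rook_zero; rewrite ?idemE ?unitE.
- move=> e f; rewrite !idemE => eE fE; split; rewrite ?idemE.
  + by move: e f eE fE => [[[] [[]|]]|] [[[] [[]|]]|].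
  + by move: e f eE fE => [[[] [[]|]]|] [[[] [[]|]]|].
  + by move: e f eE fE => [[[] [[]|]]|] [[[] [[]|]]|].
  + move=> h; rewrite idemE.
    by move: e f eE fE h => [[[] [[]|]]|] // [[[] [[]|]]|] // _ _ [[[] [[]|]]|].
- by apply/subsetP; apply: rook_LP; rewrite idemE.
- move=> e; rewrite idemE => eE.
  (* Both rank-one idempotents E_00 and E_11 are conjugate to E_00; the others are their own
     representatives. *)
  pose c (x : rook2) : rook2 := if x is Some (_, Some _) then rook_unit false false else x.
  exists (c e); split; last first.
    move=> f [fL [w /rook2_unit_cases[b ->]]]; rewrite rook2_uinv; move: fL; rewrite inE.
    by move: e f eE => [[[] [[]|]]|] // [[[] [[]|]]|] // _; case: b.
  split; first by rewrite inE; move: e eE => [[[] [[]|]]|].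
  exists (rook_perm (if e is Some (i, Some _) then i else false)) => //.
  by rewrite rook2_uinv; move: e eE => [[[] [[]|]]|].
- by move=> e f; rewrite !inE; move: e f => [[[] [[]|]]|] // [[[] [[]|]]|].
- exact: rook_coxeter.
- move=> e e'; rewrite !idemE => eE e'E le.
  (* Conjugation by the transposition is needed exactly when E_11 occurs. One w serves both
     idempotents, since two comparable ones of rank one are equal. *)
  pose i (x : rook2) := if x is Some (i, Some _) then i else false.
  pose w := rook_perm (i e || i e'); exists w, (w * e * w), (w * e' * w); rewrite rook2_uinv.
  rewrite /w unitE /rook_L !inE {w}; split=> //.
    by move: e e' eE e'E le => [[[] [[]|]]|] // [[[] [[]|]]|].
  by move: e e' eE e'E le => [[[] [[]|]]|] // [[[] [[]|]]|].
- move=> e f eL fL ef; apply/subsetP=> s; rewrite !inE => /andP[/eqP->].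
  move: eL fL ef; rewrite !inE.
  by move: e f => [[[] [[]|]]|] // [[[] [[]|]]|].
- apply: rook_LP; [apply: (ucentE _ rook_S); first by right
    | apply: (ucentE _ set0); first by left | apply: (ucentE _ rook_S); first by right];
  by move=> b; rewrite ?rook_gen ?unitE ?gen0 ?inE //; case: b.
apply: rook_LP; [apply: (ustabE _ set0); first by left
    | apply: (ustabE _ set0); first by left | apply: (ustabE _ rook_S); first by right];
  by move=> b; rewrite ?rook_gen ?unitE ?gen0 ?inE //; case: b.
Qed.

Definition rook_swap : unit_type rook2 :=
  exist _ (rook_perm true) (etrans (rook2_unitE (rook_perm true)) erefl).

Lemma rook2_units (u : unit_type rook2) : u = 1 \/ u = rook_swap.
Proof.
have [b bE] := rook2_unit_cases (valP u).
by case: b bE => bE; [right | left]; apply: val_inj.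
Qed.

Lemma rook_ustab_triv e x : e \in [:: rook_perm false; rook_unit false false] ->
  lminimal rook_S (ustabg e) x.
Proof.
move=> eE v /ustabP[ve _]; case: (rook2_units v) ve => ->; first by rewrite mulg1 => _;
  apply: ubruhat_refl.
by move: eE; rewrite !inE => /orP[] /eqP->.
Qed.

Lemma rook_lstd u e : e \in [:: rook_perm false; rook_unit false false] ->
  lstd rook_L rook_S (val u * e) u e 1.
Proof.
move=> eE; split; first by rewrite mulg1.
- by move: eE; rewrite !inE => /orP[] ->; rewrite ?orbT.
- exact: rook_ustab_triv.
exact: (rminimal1 rook_renner_coxeter).
Qed.

Lemma rook_adh u v e f :
  e \in [:: rook_perm false; rook_unit false false] -> f \in [:: rook_perm false;
    rook_unit false false] ->
  idem_le e f -> ubruhat rook_S u v -> adh_plus rook_L rook_S (val u * e) (val v * f).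
Proof.
move=> eE fE ef uv; apply/(adh_plusP rook_renner_coxeter); exists u, e, 1, v, f, 1.
split; try exact: rook_lstd.
apply: (plus_le_intro rook_renner_coxeter _ ef _ uv (group1 _)).
- by have [_ ] := rook_lstd 1 eE.
- exact: rook_ustab_triv.
by rewrite mulg1; apply: ubruhat_refl.
Qed.

(** In any standard forms the right factors y and b and the left factor a are 1, so the right
    inequality forces w = 1, and the left one would put the transposition below 1. The case e = 1
    shows that the transposition is not the minimum of the group of units. *)
Lemma rook_not_adh e : e \in [:: rook_perm false; rook_unit false false] ->
  ~ adh_plus rook_L rook_S (rook_perm true * e) (rook_perm false).
Proof.
move=> eE /(adh_plusP rook_renner_coxeter)[x [e' [y [a [f [b [[rE e'L _ ymin] [sE fL amin
  bmin]]]]]]]].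
have RC := rook_renner_coxeter.
case=> [_ [w1 [w2 [_ _ le1 le2]]]].
have f1 : f = rook_perm false.
  move: fL sE; rewrite !inE => /or3P[] /eqP-> //;
  by case: (rook2_units a) => ->; case: (rook2_units b) => ->.
have b1 : b = 1.
  apply: (ubruhat_le1 RC); rewrite -(mulVg b); apply: bmin.
  by rewrite groupV f1; apply/ucentP; case: (rook2_units b) => ->.
have a1 : a = 1.
  apply: val_inj; move: sE; rewrite f1 b1 mulg1.
  by case: (rook2_units a) => ->.
have [y1 x1] : y = 1 /\ x = rook_swap.
  have y1' : e' = rook_perm false -> y = 1.
    move=> e'1; apply: (ubruhat_le1 RC); rewrite -(mulVg y); apply: ymin.
    by rewrite groupV e'1; apply/ucentP; case: (rook2_units y) => ->.
  have swap1 : rook_swap <> 1 by move/(congr1 val).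
  move: e'L eE rE y1'; rewrite !inE => e'L eE.
  case: (rook2_units x) => ->; case: (rook2_units y) => ->;
    case/orP: eE => /eqP->; case/or3P: e'L => /eqP-> //;
    by move=> _ /(_ erefl)/swap1.
rewrite y1 b1 mulg1 in le2; move: le1;
  rewrite -(invgK (w1 * w2)) (ubruhat_le1 RC le2) a1 invg1 mulg1 x1.
by move/(ubruhat_le1 RC)/(congr1 val).
Qed.

(** The first two clauses ensure that the failure comes from the comparison and not from a missing
    minimum. *)
Lemma rook_counterexample :
  let r := rook_perm true * rook_unit false false in
  [/\ exists m, is_min_class rook_L rook_S AdhPlus GreenH r m,
      exists n, is_min_class rook_L rook_S AdhPlus GreenH 1 n,
      some_class_le rook_L rook_S AdhPlus GreenH r 1
    & ~ min_class_le rook_L rook_S AdhPlus GreenH r 1].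
Proof.
move=> r; have RC := rook_renner_coxeter.
have eE : rook_unit false false \in [:: rook_perm false; rook_unit false false] by [].
have idE : rook_perm false \in [:: rook_perm false; rook_unit false false] by [].
have rH t : greenH r t -> t = r.
  case=> /(greenLP RC)[u ->] /(greenRP RC)[v].
  by case: (rook2_units u) => -> //; case: (rook2_units v) => ->.
have unitH t : greenH (1 : rook2) t -> exists u : unit_type rook2, t = val u.
  by case=> /(greenLP RC)[u ->] _; exists u; rewrite mulg1.
split.
- exists r; split=> [|t /rH->]; first by [].
  by apply: (@rook_adh rook_swap rook_swap _ _ eE eE) => //; apply: ubruhat_refl.
- exists 1; split=> [|t /unitH[u ->]]; first by [].
  by rewrite -[val u]mulg1; apply: (@rook_adh 1 u _ _ idE idE) => //; apply: (ubruhat_ge1 RC).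
- exists r, (val rook_swap * rook_perm false); split; first by [].
    split; [apply/(greenLP RC) | apply/(greenRP RC)]; by exists rook_swap.
  by apply: (@rook_adh rook_swap rook_swap _ _ eE idE) => //; apply: ubruhat_refl.
case=> m [n [[rm _] [/unitH[u ->] nmin] mn]].
(* If the minimum of the class of 1 is 1, the comparison with r is refuted; if it is the
   transposition, its minimality against 1 is. *)
have [uE|uE] := rook2_units u.
  by apply: (rook_not_adh eE); move: mn; rewrite (rH _ rm) uE.
apply: (@rook_not_adh (rook_perm false)) => //.
by have := nmin 1 (conj erefl erefl); rewrite uE.
Qed.

Theorem theorem5p6 :
  (forall (R : finMonoidType) (L S : {set R}), renner_coxeter L S ->
     forall (eps : adh_sign) (r s : R),
       (forall T : green, T <> GreenH ->
          (min_class_le L S eps T r s <-> max_class_le L S eps T r s) /\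
          (max_class_le L S eps T r s <-> some_class_le L S eps T r s)) /\
       (max_class_le L S eps GreenH r s <-> some_class_le L S eps GreenH r s)) /\
  (exists (R : finMonoidType) (L S : {set R}), renner_coxeter L S /\
     exists (eps : adh_sign) (r s : R),
       [/\ exists m, is_min_class L S eps GreenH r m,
           exists n, is_min_class L S eps GreenH s n,
           ~ (min_class_le L S eps GreenH r s <-> max_class_le L S eps GreenH r s)
         & ~ (min_class_le L S eps GreenH r s <-> some_class_le L S eps GreenH r s)]).
Proof.
split.
  move=> R L S RC eps r s.
  have max_iff T : max_class_le L S eps T r s <-> some_class_le L S eps T r s.
    by split; [apply: max_some | apply: some_max].
  split=> // T TH; split=> //; split.
    by move/min_some/(some_max RC).
  by move/max_some/(some_min RC TH).
have [hm hn hsome hmin] := rook_counterexample.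
exists rook2, rook_L, rook_S; split; first exact: rook_renner_coxeter.
exists AdhPlus, (rook_perm true * rook_unit false false), 1; split=> //.
  by case=> _; move/(_ (some_max rook_renner_coxeter hsome)).
by case=> _ /(_ hsome).
Qed.
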